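(* Let $\kappa$ be an infinite cardinal number. Then the following three statements hold. (i) If $\lambda$ is a cardinal number with $2\le\lambda\le\kappa$, then there exists a lattice $L$ with $|\mathrm{Con}(L)|=\lambda$, $|\mathrm{Filt}(L)|=\kappa$ and $|\mathrm{Id}(L)|=2^\kappa$. (ii) There exists a distributive lattice $L$ with $|\mathrm{Con}(L)|=2^\kappa$, $|\mathrm{Filt}(L)|=\kappa$ and $|\mathrm{Id}(L)|=2^\kappa$. (iii) Let $p$ be a prime number or $p=0$, and let $m,n$ be nonnegative integers with $m+n\ge 1$. Then there exists a modular lattice $L\in\mathcal V_p$ such that $L$ generates the lattice variety $\mathcal V_p$, and $|\mathrm{Con}(L)|=2^m\cdot 3^n$, $|\mathrm{Filt}(L)|=\kappa$, $|\mathrm{Id}(L)|=2^\kappa$. Moreover, for $(m,n)=(1,0)$ such a lattice $L$ can be taken to be, in addition, relatively complemented.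
   Context: For a lattice $L$, $\mathrm{Con}(L)$, $\mathrm{Filt}(L)$ and $\mathrm{Id}(L)$ denote the set (lattice) of all congruences, of all (nonempty) filters, and of all (nonempty) ideals of $L$, respectively. Lattices are not assumed to be bounded. For $p$ a prime number or $p=0$, $\mathcal V_p$ denotes the variety of lattices generated by the congruence lattices $\mathrm{Con}(V)$ of all vector spaces $V$ over the prime field of characteristic $p$ (that is, $\mathbb Z/p\mathbb Z$ if $p$ is prime, and $\mathbb Q$ if $p=0$). A lattice $L\in\mathcal V_p$ generates $\mathcal V_p$ iff $L$ satisfies exactly the same lattice identities that are satisfied by all members of $\mathcal V_p$. *)

(* Defs.v *)
From HB Require Import structures.
From Stdlib Require Export RelationClasses.
From mathcomp Require Export all_boot all_order all_algebra.
From mathcomp Require Export mathcomp_extra boolp classical_sets functions.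
From mathcomp Require Export cardinality.

Set Implicit Arguments.
Unset Strict Implicit.
Unset Printing Implicit Defensive.

Import Order.Theory GRing.Theory.

#[global] Open Scope classical_set_scope.
#[global] Open Scope card_scope.

Section Lattice.
Context {d : Order.disp_t} (L : latticeType d).
Local Open Scope order_scope.
Implicit Types x y z : L.

Definition lattice_congruence (R : L -> L -> Prop) : Prop :=
  [/\ Equivalence R,
      forall x x' y y', R x x' -> R y y' ->
        R (Order.meet x y) (Order.meet x' y')
    & forall x x' y y', R x x' -> R y y' ->
        R (Order.join x y) (Order.join x' y')].

Definition lattice_filter (F : set L) : Prop :=
  [/\ F !=set0,
      forall x y, F x -> x <= y -> F y
    & forall x y, F x -> F y -> F (Order.meet x y)].

Definition lattice_ideal (I : set L) : Prop :=
  [/\ I !=set0,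
      forall x y, I y -> x <= y -> I x
    & forall x y, I x -> I y -> I (Order.join x y)].

Definition Con : set (L -> L -> Prop) := [set R | lattice_congruence R].
Definition Filt : set (set L) := [set F | lattice_filter F].
Definition Id : set (set L) := [set I | lattice_ideal I].

Definition modular : Prop := forall x y z, x <= z ->
  Order.join x (Order.meet y z) = Order.meet (Order.join x y) z.

Definition relatively_complemented : Prop := forall a b x, a <= x -> x <= b ->
  exists y, Order.meet x y = a /\ Order.join x y = b.

End Lattice.

Arguments Con {d} L.
Arguments Filt {d} L.
Arguments Id {d} L.
Arguments modular {d} L.
Arguments relatively_complemented {d} L.

Inductive lterm : Type :=
| LVar of nat
| LMeet of lterm & lterm
| LJoin of lterm & lterm.

Fixpoint leval d (L : latticeType d) (v : nat -> L) (t : lterm) : L :=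
  match t with
  | LVar i => v i
  | LMeet s t => Order.meet (leval v s) (leval v t)
  | LJoin s t => Order.join (leval v s) (leval v t)
  end.

Definition lidentity : Type := (lterm * lterm)%type.

Definition satisfies d (L : latticeType d) (e : lidentity) : Prop :=
  forall v : nat -> L, leval v e.1 = leval v e.2.

Definition lattice_class : Type :=
  forall d : Order.disp_t, latticeType d -> Prop.

Definition variety (W : lattice_class) : Prop :=
  exists E : set lidentity, forall d (L : latticeType d),
    W d L <-> forall e, E e -> satisfies L e.

Definition variety_generated_by (C : lattice_class) : lattice_class :=
  fun d L => forall W : lattice_class,
    variety W -> (forall d' (M : latticeType d'), C d' M -> W d' M) -> W d L.

Inductive singleton_class d (L : latticeType d) : lattice_class :=
| singleton_class_self : singleton_class L L.

Definition generates d (L : latticeType d) (W : lattice_class) : Prop :=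
  forall d' (M : latticeType d'),
    variety_generated_by (singleton_class L) M <-> W d' M.

Section VectorSpaceCongruences.
Context {F : fieldType} (V : lmodType F).
Local Open Scope ring_scope.
Implicit Types u v : V.

(* Compatibility with opposites is the case a = -1 of the last clause. *)
Definition vs_congruence (R : V -> V -> Prop) : Prop :=
  [/\ Equivalence R,
      forall u u' v v', R u u' -> R v v' -> R (u + v) (u' + v')
    & forall a u u', R u u' -> R (a *: u) (a *: u')].

Record vs_Con : Type := VsCon {
  vs_rel :> V -> V -> Prop;
  vs_relP : vs_congruence vs_rel
}.

HB.instance Definition _ := gen_eqMixin vs_Con.
HB.instance Definition _ := gen_choiceMixin vs_Con.

Implicit Types R S T : vs_Con.

Lemma vs_Con_ext R S : (forall u v, R u v <-> S u v) -> R = S.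
Proof.
case: R S => [R hR] [S hS] /= RS.
have E : R = S by apply/funext => u; apply/funext => v; apply/propext.
by case: _ / E hS => hS; rewrite (Prop_irrelevance hR hS).
Qed.

Lemma vs_bigcap_congruence (P : set vs_Con) :
  vs_congruence (fun u v => forall R, P R -> R u v).
Proof.
split; first split.
- by move=> u R _; case: (vs_relP R) => -[].
- by move=> u v h R PR; case: (vs_relP R) => -[_ sR _] _ _; apply/sR/h.
- move=> u v w h k R PR; case: (vs_relP R) => -[_ _ tR] _ _.
  exact: tR (h R PR) (k R PR).
- move=> u u' v v' h k R PR; case: (vs_relP R) => _ aR _.
  by apply: aR; [apply: h|apply: k].
- by move=> a u u' h R PR; case: (vs_relP R) => _ _; apply; apply: h.
Qed.

Definition vs_bigcap (P : set vs_Con) : vs_Con :=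
  VsCon (vs_bigcap_congruence P).

Definition vs_le R S : bool := `[< forall u v, R u v -> S u v >].

Definition vs_meet R S : vs_Con := vs_bigcap [set T | T = R \/ T = S].

Definition vs_join R S : vs_Con := vs_bigcap [set T | vs_le R T /\ vs_le S T].

Lemma vs_le_refl : reflexive vs_le.
Proof. by move=> R; apply/asboolP. Qed.

Lemma vs_le_anti : antisymmetric vs_le.
Proof.
move=> R S /andP[/asboolP RS /asboolP SR].
by apply: vs_Con_ext => u v; split; [apply: RS|apply: SR].
Qed.

Lemma vs_le_trans : transitive vs_le.
Proof.
move=> S R T /asboolP RS /asboolP ST.
by apply/asboolP => u v /RS /ST.
Qed.

Fact vs_Con_display : Order.disp_t. Proof. exact: Order.Disp tt tt. Qed.

HB.instance Definition _ := Order.Le_isPOrder.Build vs_Con_display vs_Con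
  vs_le_refl vs_le_anti vs_le_trans.

Lemma vs_meetP R S T : (R <= vs_meet S T)%O = (R <= S)%O && (R <= T)%O.
Proof.
apply/asboolP/andP => [h|[/asboolP RS /asboolP RT] u v Ruv U [->|->]].
- by split; apply/asboolP => u v /h /(_ _); apply; [left|right].
- exact: RS.
- exact: RT.
Qed.

Lemma vs_joinP R S T : (vs_join R S <= T)%O = (R <= T)%O && (S <= T)%O.
Proof.
apply/asboolP/andP => [h|[RT ST] u v]; last by apply.
split; apply/asboolP => u v uv; apply: h => U [/asboolP RU /asboolP SU].
  exact: RU.
exact: SU.
Qed.

HB.instance Definition _ := Order.POrder_MeetJoin_isLattice.Build
  vs_Con_display vs_Con vs_meetP vs_joinP.

End VectorSpaceCongruences.

Inductive vs_Con_class (F : fieldType) : lattice_class :=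
| vs_Con_class_intro (V : lmodType F) : vs_Con_class F (vs_Con V).

(* The carrier of ['F_p] is [Z/pZ] only for [p] prime. *)
Definition prime_field (p : nat) : fieldType :=
  match p with
  | 0 => rat
  | _ => 'F_p
  end.

Definition variety_p (p : nat) : lattice_class :=
  variety_generated_by (vs_Con_class (prime_field p)).

(* Main.v *)
From HB Require Import structures.
Require Import Defs.
From mathcomp Require Import finmap wochoice.

Set Implicit Arguments.
Unset Strict Implicit.
Unset Printing Implicit Defensive.

Import Order.TTheory GRing.Theory.

(** Why few filters and many ideals are compatible: in a lattice with the
    descending chain condition every filter is principal, so there are only as
    many filters as elements ([card_Filt_dcc]), whereas nothing limits the
    ideals. The finite subsets of [K] already show this: ideals and congruences
    both correspond to arbitrary subsets of [K], and the lattice is distributive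
    ([finsubset_Con]).

    For the varieties generated by congruence lattices of vector spaces, let [V]
    be the space of finitely supported functions from [K] to the prime field.
    Its finitely generated subspaces satisfy the descending chain condition, are
    modular and relatively complemented, and have one ideal at least for every
    subset of [K]. Any congruence relating two distinct subspaces collapses a
    line, hence by perspectivity every line, hence everything
    ([fg_cong_collapse]); so there are exactly two congruences. Putting [V]
    itself on top adds the congruence that isolates the top ([fg_Con3]), which
    makes three. An identity failing for subspaces of some space [U] fails
    because of finitely many vectors, and pulling back along a linear map from
    [V] that reaches these vectors turns this into a failure among finitely
    generated subspaces of [V] ([fg_satisfies_Con]). Lattices have a majority
    term, so congruences of a product of two lattices are products of
    congruences ([Con_prod]), and products of the two lattices above realize
    every number of congruences [2 ^ m * 3 ^ n].

    To get an arbitrary number of congruences, nest copies of the lattice M_3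
    along a well-ordered set [W], each copy taking the place of the third atom
    of the previous one, with a simple lattice of subspaces in the core. As M_3
    is simple, a congruence that collapses something at a level collapses this
    whole level and all that is inside it, and each such block can be collapsed
    alone. Hence a congruence other than equality collapses just the core or
    everything from some level on, and there are two more congruences than
    levels ([nest_Con]). The tops of the levels form a descending chain, so the
    descending chain condition fails, but the filters that are not principal
    consist of tops only and are no more than the levels plus one
    ([nest_filter]).

    The sizes are computed with the theorem that an infinite set has as many
    elements as its square ([card_square]), proved here by Zorn's lemma. *)

(** * Cardinal arithmetic *)

Lemma card_le_inj T U (A : set T) (B : set U) (f : T -> U) :
  (forall x, A x -> B (f x)) ->
  (forall x y, A x -> A y -> f x = f y -> x = y) -> A #<= B.
Proof.
move=> fAB fI; have : $|{injfun A >-> B}|.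
  by apply/injfunPex; exists f => // x y /set_mem Ax /set_mem Ay; apply: fI.
by case=> g; apply: inj_card_le g.
Qed.

Lemma card_eq_can T U (A : set T) (B : set U) (f : T -> U) (g : U -> T) :
  (forall x, A x -> B (f x)) -> (forall y, B y -> A (g y)) ->
  (forall x, A x -> g (f x) = x) -> (forall y, B y -> f (g y) = y) -> A #= B.
Proof.
move=> fAB gBA gf fg; apply: Cantor_Bernstein.
  by apply: (card_le_inj (f := f)) => // x y /gf{2}<- /gf{2}<- ->.
by apply: (card_le_inj (f := g)) => // x y /fg{2}<- /fg{2}<- ->.
Qed.

Lemma card_leTP T U :
  [set: T] #<= [set: U] <-> exists f : T -> U, injective f.
Proof.
split=> [/card_leP[f]|[f fI]].
  exists (fun x => val (f (to_setT x))) => x y /val_inj /inj.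
  by move=> /(_ (mem_set I) (mem_set I)) /(congr1 val).
by apply: (card_le_inj (f := f)) => // x y _ _; apply: fI.
Qed.

Lemma chain_pair U (F : set (set U)) (X Y : set U) (p q : U) :
  total_on F subset -> F X -> F Y -> X p -> Y q ->
  exists2 Z, F Z & Z p /\ Z q.
Proof.
move=> totF FX FY Xp Yq; have [XY|YX] := totF _ _ FX FY.
  by exists Y => //; split=> //; apply: XY.
by exists X => //; split=> //; apply: YX.
Qed.

Section CardComparability.
Variables (T : Type) (A B : set T).

Let partial_injection (G : set (T * T)) : Prop :=
  [/\ forall x y, G (x, y) -> A x /\ B y,
      forall x y y', G (x, y) -> G (x, y') -> y = y'
    & forall x x' y, G (x, y) -> G (x', y) -> x = x'].

(** A maximal partial injection from [A] to [B] is defined on the whole of [A]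
    or reaches the whole of [B]. *)
Lemma injection_total :
  (exists f : T -> T, (forall x, A x -> B (f x)) /\
     (forall x y, A x -> A y -> f x = f y -> x = y)) \/
  (exists f : T -> T, (forall x, B x -> A (f x)) /\
     (forall x y, B x -> B y -> f x = f y -> x = y)).
Proof.
have [|G [[GAB Gfun Ginj] Gmax]] := @Zorn_bigcup _ partial_injection.
  move=> F FP totF; split.
  - by move=> x y [X /FP[XAB _ _] /XAB].
  - move=> x y y' [X FX Xxy] [Y FY Yxy'].
    by have [Z /FP[_ h _] []] := chain_pair totF FX FY Xxy Yxy'; apply: h.
  - move=> x x' y [X FX Xxy] [Y FY Yxy'].
    by have [Z /FP[_ _ h] []] := chain_pair totF FX FY Xxy Yxy'; apply: h.
have [Adom|] := pselect (forall x, A x -> exists y, G (x, y)).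
  left; have /choice[f fG] : forall x, exists y, A x -> G (x, y).
    move=> x; have [/Adom[y Gxy]|nAx] := pselect (A x); first by exists y.
    by exists x.
  exists f; split=> [x Ax|x y Ax Ay fxy]; first by have [] := GAB _ _ (fG _ Ax).
  by apply: (Ginj _ _ (f x)); [exact: fG|rewrite fxy; exact: fG].
move=> /existsNP[a /not_implyP[Aa aG]].
have [Bim|] := pselect (forall y, B y -> exists x, G (x, y)).
  right; have /choice[f fG] : forall y, exists x, B y -> G (x, y).
    move=> y; have [/Bim[x Gxy]|nBy] := pselect (B y); first by exists x.
    by exists y.
  exists f; split=> [x Bx|x y Bx By fxy]; first by have [] := GAB _ _ (fG _ Bx).
  by apply: (Gfun (f x)); [exact: fG|rewrite fxy; exact: fG].
move=> /existsNP[b /not_implyP[Bb bG]].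
exfalso; apply: (Gmax (G `|` [set (a, b)])).
  split; first exact: subsetUl.
  by move=> /(_ (a, b) (or_intror erefl)) Gab; apply: aG; exists b.
split.
- by move=> x y [/GAB//|[-> ->]].
- move=> x y y' [Gxy|[-> ->]] [Gxy'|[]].
  + exact: Gfun Gxy Gxy'.
  + by move=> xa _; case: aG; exists y; rewrite -xa.
  + by case: aG; exists y'.
  + by move=> ->.
- move=> x x' y [Gxy|[-> ->]] [Gxy'|[]].
  + exact: Ginj Gxy Gxy'.
  + by move=> _ yb; case: bG; exists x; rewrite -yb.
  + by case: bG; exists x'.
  + by move=> ->.
Qed.

End CardComparability.

Section CardSquare.
Variables (K : Type) (K_infinite : infinite_set [set: K]).

(* Graphs rather than functions, so that unions of chains are again pairings. *)
Let dom (G : set ((K * K) * K)) : set K := [set x | exists z, G ((x, x), z)].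

Let pairing (G : set ((K * K) * K)) : Prop :=
  [/\ forall x y z, G ((x, y), z) -> [/\ dom G x, dom G y & dom G z],
      forall x y, dom G x -> dom G y -> exists z, G ((x, y), z),
      forall p z z', G (p, z) -> G (p, z') -> z = z'
    & forall p p' z, G (p, z) -> G (p', z) -> p = p'].

Lemma nat_embedding : exists f : nat -> K, injective f.
Proof. exact/card_leTP/infiniteP. Qed.

Lemma nat_pairing : exists2 G, pairing G & exists f : nat -> K,
  injective f /\ forall n, dom G (f n).
Proof.
have [f fI] := nat_embedding.
have /card_eqPle[/card_leTP[c cI] _] := card_nat2.
pose G : set ((K * K) * K) :=
  [set p | exists m n, p = ((f m, f n), f (c (m, n)))].
have dG n : dom G (f n) by exists (f (c (n, n))); exists n, n.
exists G; last by exists f.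
split.
- by move=> x y z [m [n [-> -> ->]]].
- by move=> x y [? [m [? [-> _ _]]]] [? [n [? [-> _ _]]]]; exists (f (c (m, n))), m, n.
- move=> p z z' [m [n [-> ->]]] [m' [n' [e1 e2 ->]]].
  by move: e1 e2 => /fI -> /fI ->.
- by move=> p p' z [m [n [-> ->]]] [m' [n' [-> /fI/cI[-> ->]]]].
Qed.

(* The chains to which Zorn's lemma is applied may be empty, whence the empty
   graph next to the graphs that extend the pairing of the natural numbers. *)
Lemma maximal_pairing : exists G, [/\ pairing G,
  exists f : nat -> K, injective f /\ forall n, dom G (f n) &
  forall H, pairing H -> G `<=` H -> H `<=` G].
Proof.
have [G0 G0p [f [fI fG0]]] := nat_pairing.
have domS G H : G `<=` H -> dom G `<=` dom H.
  by move=> GH x [z /GH]; exists z.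
have [|G [GP Gmax]] :=
    @Zorn_bigcup _ [set G | G = set0 \/ (G0 `<=` G /\ pairing G)].
  move=> F FP totF.
  have [[X0 FX0 X0n]|Fn] := pselect (exists2 X, F X & X !=set0); last first.
    left; rewrite -subset0 => p [X FX Xp]; case: Fn.
    by exists X => //; exists p.
  right; have FP' X p : F X -> X p -> G0 `<=` X /\ pairing X.
    by move=> /FP[->|].
  have domF X : F X -> dom X `<=` dom (\bigcup_(X in F) X).
    by move=> FX; apply: domS => p Xp; exists X.
  split; [|split].
  - move=> p G0x; exists X0 => //; case: X0n => q /(FP' _ _ FX0)[+ _]; exact.
  - move=> x y z [X FX Xxyz]; have [_ [h _ _ _]] := FP' _ _ FX Xxyz.
    by have [? ? ?] := h _ _ _ Xxyz; split; apply: (domF _ FX).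
  - move=> x y [u [X FX Xx]] [v [Y FY Yy]].
    have [Z FZ [Zx Zy]] := chain_pair totF FX FY Xx Yy.
    have [_ [_ h _ _]] := FP' _ _ FZ Zx.
    have [||w Zw] := h x y; [by exists u|by exists v|].
    by exists w; exists Z.
  - move=> p z z' [X FX Xx] [Y FY Yy].
    have [Z FZ [Zx Zy]] := chain_pair totF FX FY Xx Yy.
    by have [_ [_ _ h _]] := FP' _ _ FZ Zx; apply: h Zx Zy.
  - move=> p p' z [X FX Xx] [Y FY Yy].
    have [Z FZ [Zx Zy]] := chain_pair totF FX FY Xx Yy.
    by have [_ [_ _ _ h]] := FP' _ _ FZ Zx; apply: h Zx Zy.
have G0n : G0 !=set0 by have [z ?] := fG0 0; exists (f 0, f 0, z).
have [GE|[G0G Gp]] := GP.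
  exfalso; apply: (Gmax G0); last by right; split.
  rewrite GE; split; first exact: sub0set.
  by case: G0n => p G0p' /(_ _ G0p').
exists G; split=> //.
  by exists f; split=> // n; apply: (domS _ _ G0G).
move=> H Hp GH; apply: contrapT => nHG; apply: (Gmax H).
  by split.
by right; split=> //; apply: subset_trans GH.
Qed.

(** Take a maximal set that embeds its own square. If its complement is no
    larger, all of [K] embeds in it; otherwise the complement contains a
    disjoint copy of it, and the embedding of the square extends to the union
    with this copy. *)
Theorem card_square : [set: K * K] #<= [set: K].
Proof.
have [G [[Gdom Gtot Gfun Ginj] [nu [nuI nuG]] Gmax]] := maximal_pairing.
have [x0 x0G] : exists x0, dom G x0 by exists (nu 0).
have /choice[g gG] : forall p : K * K, exists z,
    dom G p.1 -> dom G p.2 -> G (p, z).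
  move=> [x y]; have [[dx dy]|ndxy] := pselect (dom G x /\ dom G y).
    by have [z] := Gtot _ _ dx dy; exists z.
  by exists x0 => ? ?; case: ndxy.
have gdom x y : dom G x -> dom G y -> dom G (g (x, y)).
  by move=> dx dy; have [] := Gdom _ _ _ (gG (x, y) dx dy).
have gI x y x' y' : dom G x -> dom G y -> dom G x' -> dom G y' ->
    g (x, y) = g (x', y') -> x = x' /\ y = y'.
  move=> dx dy dx' dy' e; have := gG (x, y) dx dy; rewrite e.
  by move=> /Ginj/(_ (gG (x', y') dx' dy')) [-> ->].
have [[h [hG hI]]|[h [hG hI]]] := injection_total (~` dom G) (dom G).
  (* The complement of the domain is small, so [K] itself embeds in it. *)
  pose k x := if `[< dom G x >] then g (x, nu 0) else g (h x, nu 1).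
  have kG x : dom G (k x) by rewrite /k; case: asboolP => ?; apply: (gdom); auto.
  have kI : injective k.
    move=> x y; rewrite /k; case: asboolP => dx; case: asboolP => dy.
    - by case/gI.
    - by case/gI; auto => _ /nuI.
    - by case/gI; auto => _ /nuI.
    - by case/gI; auto => /hI.
  apply/card_leTP; exists (fun p => g (k p.1, k p.2)) => -[x y] [x' y'] /=.
  by case/gI => // /kI -> /kI ->.
(* Otherwise the domain has a disjoint copy, to which the pairing extends. *)
pose e (b : bool) x := if b then h x else x.
have eI b c x y : dom G x -> dom G y -> e b x = e c y -> b = c /\ x = y.
  move=> dx dy; rewrite /e; case: b; case: c => //.
  - by move=> /hI ->.
  - by move=> E; case: (hG _ dx); rewrite E.
  - by move=> E; case: (hG _ dy); rewrite -E.
(* [tag] separates the blocks of the square of the doubled domain, since the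
   new values of all of them lie in the copy. *)
pose tag (b c : bool) := nu (b + c.*2).
have tagI b c b' c' : tag b c = tag b' c' -> b = b' /\ c = c'.
  by move=> /nuI; case: b; case: c; case: b'; case: c'.
pose v b c x y := h (g (tag b c, g (x, y))).
have vI b c x y b' c' x' y' : dom G x -> dom G y -> dom G x' -> dom G y' ->
    v b c x y = v b' c' x' y' -> [/\ b = b', c = c', x = x' & y = y'].
  have gt i j u w : dom G u -> dom G w -> dom G (g (tag i j, g (u, w))).
    by move=> du dw; apply: (gdom); [exact: nuG|exact: (gdom)].
  move=> dx dy dx' dy' E.
  have {}E := hI _ _ (gt _ _ _ _ dx dy) (gt _ _ _ _ dx' dy') E.
  have [] := gI _ _ _ _ (nuG _) (gdom _ _ dx dy) (nuG _) (gdom _ _ dx' dy') E.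
  by move=> /tagI[-> ->] {}E; have [-> ->] := gI _ _ _ _ dx dy dx' dy' E.
pose H : set ((K * K) * K) := G `|` [set p | exists b c x y,
  [/\ b || c, dom G x, dom G y & p = ((e b x, e c y), v b c x y)]].
have GH : G `<=` H by exact: subsetUl.
have domH x : dom H x <-> exists b y, dom G y /\ x = e b y.
  split.
    move=> [z [Gx|[b [c [y [y' [_ dy dy' [-> _ _]]]]]]]]; last by exists b, y.
    by exists false, x; split=> //; exists z.
  move=> [[] [y [dy ->]]]; last by case: dy => z Gz; exists z; apply: GH.
  by exists (v true true y y); right; exists true, true, y, y.
have vdom b c x y : dom G x -> dom G y -> ~ dom G (v b c x y).
  by move=> dx dy; apply: hG; apply: (gdom); [exact: nuG|exact: (gdom)].
have Hp : pairing H.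
  split.
  - move=> x y z [Gxyz|[b [c [x' [y' [bc dx dy [-> -> ->]]]]]]].
      have [dx dy dz] := Gdom _ _ _ Gxyz.
      by split; apply/domH; [exists false, x|exists false, y|exists false, z].
    split; apply/domH; [by exists b, x'|by exists c, y'|].
    by exists true, (g (tag b c, g (x', y'))); split=> //; apply: (gdom);
      [exact: nuG|exact: (gdom)].
  - move=> _ _ /domH[b [x [dx ->]]] /domH[c [y [dy ->]]].
    have [bc|] := boolP (b || c).
      by exists (v b c x y); right; exists b, c, x, y.
    by case: b; case: c => // _; exists (g (x, y)); left; apply: (gG (x, y)).
  - move=> p z z' [Gp|[b [c [x [y [bc dx dy [-> ->]]]]]]].
      move=> [/(Gfun _ _ _ Gp)//|[b [c [x [y [bc dx dy [E _]]]]]]].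
      move: Gp; rewrite E => /Gdom[dx' dy' _].
      by move: bc; have [<- _] := @eI false b _ x dx' dx erefl;
        have [<- _] := @eI false c _ y dy' dy erefl.
    move=> [/Gdom[dx' dy' _]|[b' [c' [x' [y' [bc' dx' dy' [+ + ->]]]]]]].
      by move: bc; have [<- _] := @eI false b _ x dx' dx erefl;
        have [<- _] := @eI false c _ y dy' dy erefl.
    by move=> /(eI _ _ _ _ dx dx')[-> ->] /(eI _ _ _ _ dy dy')[-> ->].
  - move=> p p' z [Gp|[b [c [x [y [bc dx dy [-> ->]]]]]]].
      move=> [/(Ginj _ _ _ Gp)//|[b [c [x [y [bc dx dy [_ E]]]]]]].
      by case: p Gp => u w /Gdom[_ _]; rewrite E => /(vdom _ _ _ _ dx dy).
    move=> [|[b' [c' [x' [y' [bc' dx' dy' [-> +]]]]]]].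
      by case: p' => u w /Gdom[_ _] /(vdom _ _ _ _ dx dy).
    by move=> /(vI _ _ _ _ _ _ _ _ dx dy dx' dy')[-> -> -> ->].
have /(_ (h x0, x0, v true false x0 x0)) := Gmax H Hp GH.
have Hnew : H (h x0, x0, v true false x0 x0).
  by right; exists true, false, x0, x0.
by move=> /(_ Hnew) /Gdom[/(hG _ x0G)].
Qed.

End CardSquare.

Section CardAbsorption.
Variables (K : Type) (K_infinite : infinite_set [set: K]).
Implicit Types S T : Type.

Lemma card_prod_le S T : [set: S] #<= [set: K] -> [set: T] #<= [set: K] ->
  [set: S * T] #<= [set: K].
Proof.
move=> /card_leTP[f fI] /card_leTP[g gI].
apply: card_le_trans (card_square K_infinite).
by apply/card_leTP; exists (fun p => (f p.1, g p.2)) => -[x y] [u v] [/fI-> /gI->].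
Qed.

Lemma card_nat_le : [set: nat] #<= [set: K].
Proof. exact/infiniteP. Qed.

Lemma card_sum_le S T : [set: S] #<= [set: K] -> [set: T] #<= [set: K] ->
  [set: S + T] #<= [set: K].
Proof.
move=> leS leT; have leN := card_nat_le.
have := card_prod_le leN (card_square K_infinite).
apply: card_le_trans; move: leS leT => /card_leTP[f fI] /card_leTP[g gI].
have [nu _] := nat_embedding K_infinite.
apply/card_leTP; exists (fun u => match u with
  | inl x => (0, (f x, nu 0)) | inr y => (1, (nu 0, g y)) end).
by move=> [x|y] [x'|y'] // [] => [/fI->|/gI->].
Qed.

Lemma card_option_le T : [set: T] #<= [set: K] -> [set: option T] #<= [set: K].
Proof.
move=> leT; have leU : [set: unit] #<= [set: K].
  by apply: card_le_trans card_nat_le; apply/card_leTP; exists (fun=> 0) => -[] [].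
apply: card_le_trans (card_sum_le leT leU).
apply/card_leTP; exists (fun u => if u is Some x then inl x else inr tt).
by move=> [x|] [y|] // [->].
Qed.

(** A list is recovered from its length and the iterated pairing of its entries. *)
Lemma card_seq_le T : [set: T] #<= [set: K] -> [set: seq T] #<= [set: K].
Proof.
move=> /card_leTP[f fI]; have /card_leTP[g gI] := card_square K_infinite.
have [nu _] := nat_embedding K_infinite.
pose code := foldr (fun x k => g (f x, k)) (nu 0).
apply: card_le_trans (card_prod_le card_nat_le (card_lexx [set: K])).
apply/card_leTP; exists (fun s => (size s, code s)).
by elim=> [|x s IH] [|y t] //= [sz /gI[/fI-> e]]; rewrite (IH t) // sz e.
Qed.

Lemma card_power_le T : [set: T] #<= [set: K] ->
  [set: set T] #<= [set: set K].
Proof.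
move=> /card_leTP[f fI]; apply/card_leTP; exists (image^~ f).
suff H (A B : set T) : f @` A = f @` B -> A `<=` B.
  by move=> A B e; apply/seteqP; split; apply: H.
by move=> e x Ax; have : (f @` A) (f x) by [exists x]; rewrite e => -[y By /fI<-].
Qed.

End CardAbsorption.

Lemma card_setX_II T U (A : set T) (B : set U) m n :
  A #= `I_m -> B #= `I_n -> A `*` B #= `I_(m * n).
Proof.
move=> /card_set_bijP[f [fA fI fS]] /card_set_bijP[g [gB gI gS]].
apply/card_set_bijP; exists (fun p => f p.1 * n + g p.2); split.
- move=> [x y] [/= /fA fx /gB gy].
  rewrite /= in fx gy *; apply: (@leq_trans ((f x).+1 * n)).
    by rewrite mulSn addnC ltn_add2r.
  by rewrite leq_mul2r fx orbT.
- move=> [x y] [x' y'] /set_mem[/= Ax By] /set_mem[/= Ax' By'] e.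
  have gy := gB _ By; have gy' := gB _ By'; rewrite /= in gy gy'.
  have n0 : 0 < n by apply: leq_ltn_trans gy.
  have := congr1 (divn^~ n) e; have := congr1 (modn^~ n) e.
  rewrite !modnMDl !modn_small // !divnMDl // !divn_small // !addn0.
  by move=> /(gI _ _ (mem_set By) (mem_set By'))-> /(fI _ _ (mem_set Ax) (mem_set Ax'))->.
- move=> k /= kmn; have n0 : 0 < n by case: n kmn {gB gS} => //; rewrite muln0.
  have [x Ax fx] := fS (k %/ n) (eqbRL (ltn_divLR _ _ n0) kmn).
  have [y By gy] := gS (k %% n) (ltn_pmod _ n0).
  by exists (x, y) => //=; rewrite fx gy -divn_eq.
Qed.

(** * Filters, ideals and congruences of general lattices *)

Section FiltersIdeals.
Context {d : Order.disp_t} (L : latticeType d).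
Local Open Scope order_scope.

Definition dcc : Prop := forall P : set L, P !=set0 ->
  exists2 m, P m & forall x, P x -> x <= m -> x = m.

(** The meet of a minimal member with any other member is a member again. *)
Lemma filter_principal (F : set L) : dcc -> lattice_filter F ->
  exists m, F = [set x | m <= x].
Proof.
move=> dccL [F0 Fup FI]; have [m Fm mmin] := dccL F F0.
exists m; apply/seteqP; split=> [x Fx|x]; last exact: Fup.
by rewrite /= -(mmin (Order.meet m x)) ?leIr ?leIl//; apply: FI.
Qed.

Lemma principal_filter (m : L) : lattice_filter [set x | m <= x].
Proof.
split; first by exists m => /=.
  by move=> x y /= mx; apply: le_trans.
by move=> x y /= mx my; rewrite lexI mx.
Qed.

Lemma principal_filter_inj : injective (fun m : L => [set x | m <= x]).
Proof.
move=> x y /= e; apply/le_anti/andP; split.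
  by move: (congr1 (@^~ y) e) => /= ->.
by move: (congr1 (@^~ x) e) => /= <-.
Qed.

Lemma card_le_Filt : [set: L] #<= Filt L.
Proof.
apply: (card_le_inj (f := fun m : L => [set x | m <= x])).
  by move=> m _; apply: principal_filter.
by move=> x y _ _; apply: principal_filter_inj.
Qed.

Lemma card_Filt_dcc : dcc -> Filt L #= [set: L].
Proof.
move=> dccL; apply: Cantor_Bernstein; last exact: card_le_Filt.
apply: (card_le_trans _ (card_image_le (fun m : L => [set x | m <= x]) setT)).
by apply: subset_card_le => F /(filter_principal dccL)[m ->]; exists m.
Qed.

Lemma card_Id (K : Type) : [set: L] #<= [set: K] ->
  [set: set K] #<= Id L -> Id L #= [set: set K].
Proof.
move=> LK KL; apply: Cantor_Bernstein => //.
apply: card_le_trans (card_leT _) _; exact: card_power_le.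
Qed.

End FiltersIdeals.

(** Passing to the down-closure embeds the ideals of a join-subsemilattice. *)
Lemma card_Id_embed dA dB (A : latticeType dA) (B : latticeType dB)
    (f : A -> B) T (X : set T) :
  (forall x y, f x <= f y -> x <= y)%O ->
  (forall x y, f (Order.join x y) = Order.join (f x) (f y)) ->
  X #<= Id A -> X #<= Id B.
Proof.
move=> fle fU XA; apply: card_le_trans XA _.
have fmono x y : (x <= y -> f x <= f y)%O.
  by move=> /join_idPr <-; rewrite fU leUl.
pose J (I : set A) := [set x | exists2 y, I y & (x <= f y)%O].
apply: (card_le_inj (f := J)).
  move=> I [[x Ix] Idown IU]; split.
  - by exists (f x), x.
  - by move=> u v [y Iy vy] uv; exists y => //; apply: le_trans vy.
  - move=> u v [y Iy uy] [z Iz vz]; exists (Order.join y z); first exact: IU.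
    by rewrite fU leU2.
suff JS I I' : Id A I' -> J I = J I' -> I `<=` I'.
  by move=> I I' HI HI' e; apply/seteqP; split; apply: JS.
move=> [_ Idown _] e x Ix; have : J I (f x) by exists x.
by rewrite e => -[y Iy /fle]; apply: Idown.
Qed.

Section Congruences.
Context {d : Order.disp_t} {L : latticeType d} {R : L -> L -> Prop}.
Hypothesis R_cong : lattice_congruence R.
Local Open Scope order_scope.

Lemma cong_refl x : R x x.
Proof. by case: R_cong => -[]. Qed.

Lemma cong_sym x y : R x y -> R y x.
Proof. by case: R_cong => -[_ s _] _ _; apply: s. Qed.

Lemma cong_trans y x z : R x y -> R y z -> R x z.
Proof. by case: R_cong => -[_ _ t] _ _; apply: t. Qed.

Lemma cong_meet x x' y y' :
  R x x' -> R y y' -> R (Order.meet x y) (Order.meet x' y').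
Proof. by case: R_cong => _ m _; apply: m. Qed.

Lemma cong_join x x' y y' :
  R x x' -> R y y' -> R (Order.join x y) (Order.join x' y').
Proof. by case: R_cong => _ _ j; apply: j. Qed.

Lemma cong_meetl z x y : R x y -> R (Order.meet z x) (Order.meet z y).
Proof. exact/cong_meet/cong_refl. Qed.

Lemma cong_joinl z x y : R x y -> R (Order.join z x) (Order.join z y).
Proof. exact/cong_join/cong_refl. Qed.

Lemma cong_convex x y u v :
  R x y -> x <= u -> u <= y -> x <= v -> v <= y -> R u v.
Proof.
suff H w : R x y -> x <= w -> w <= y -> R x w.
  by move=> Rxy xu uy xv vy; apply: (cong_trans (cong_sym (H u _ _ _))); auto.
move=> Rxy xw wy; have := cong_meetl w Rxy.
by rewrite (meet_idPl wy) (meet_idPr xw).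
Qed.

End Congruences.

(** A form of the two cardinality requirements that passes to direct products
    and needs only a lower bound for the number of ideals. *)
Definition many_ideals (K : Type) d (L : latticeType d) : Prop :=
  [/\ dcc L, [set: L] #= [set: K] & [set: set K] #<= Id L].

Lemma many_ideals_card (K : Type) d (L : latticeType d) :
  many_ideals K L -> Filt L #= [set: K] /\ Id L #= [set: set K].
Proof.
move=> [dccL LK IdL]; split; first exact: card_eq_trans (card_Filt_dcc dccL) LK.
by apply: card_Id => //; move/card_eqPle: LK => [].
Qed.

(** * Direct products *)

Section Products.
Context {dA dB : Order.disp_t} (A : latticeType dA) (B : latticeType dB).
Variables (a0 : A) (b0 : B).
Local Open Scope order_scope.

Lemma dcc_prod : dcc A -> dcc B -> dcc (A *p B).
Proof.
move=> dccA dccB P [[a1 b1] Pab].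
have [|a [b2 Pab2] amin] := dccA [set a | exists b, P (a, b)].
  by exists a1, b1.
have [|b Pb bmin] := dccB [set b | P (a, b)]; first by exists b2.
exists (a, b) => // -[x y] Pxy; rewrite leEprod /= => /andP[xa yb].
have xE : x = a by apply: amin => //; exists y.
by rewrite xE in Pxy *; rewrite (bmin y).
Qed.

Lemma modular_prod : modular A -> modular B -> modular (A *p B).
Proof.
move=> mA mB [x1 x2] [y1 y2] [z1 z2]; rewrite leEprod /= => /andP[xz1 xz2].
by rewrite !(meetEprod, joinEprod) /= mA // mB.
Qed.

Lemma leval_prod (v : nat -> A *p B) t :
  leval v t = (leval (fun i => (v i).1) t, leval (fun i => (v i).2) t).
Proof.
elim: t => [i|s IHs t IHt|s IHs t IHt] /=; first by case: (v i).
  by rewrite IHs IHt meetEprod.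
by rewrite IHs IHt joinEprod.
Qed.

Lemma satisfies_prod e :
  satisfies (A *p B) e <-> satisfies A e /\ satisfies B e.
Proof.
split=> [AB|[hA hB] v]; last by rewrite !leval_prod hA hB.
split=> v.
  by have := AB (fun i => (v i, b0)); rewrite !leval_prod => -[].
by have := AB (fun i => (a0, v i)); rewrite !leval_prod => -[].
Qed.

Definition majority d (L : latticeType d) (x y z : L) : L :=
  Order.join (Order.join (Order.meet x y) (Order.meet y z)) (Order.meet z x).

Lemma majority_prod (x y z : A *p B) : majority x y z =
  (majority x.1 y.1 z.1, majority x.2 y.2 z.2).
Proof. by rewrite /majority !(meetEprod, joinEprod). Qed.

Lemma majority12 d (L : latticeType d) (x z : L) : majority x x z = x.
Proof. by rewrite /majority meetxx !join_l ?leIl ?leIr. Qed.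

Lemma majority23 d (L : latticeType d) (x z : L) : majority z x x = x.
Proof.
by rewrite /majority meetxx (join_r (leIr _ _)) (join_l (leIl _ _)).
Qed.

Lemma majority13 d (L : latticeType d) (x z : L) : majority x z x = x.
Proof.
by rewrite /majority meetxx join_r // leUx leIl leIr.
Qed.

Lemma cong_majority d (L : latticeType d) R (x x' y y' z z' : L) :
  lattice_congruence R -> R x x' -> R y y' -> R z z' ->
  R (majority x y z) (majority x' y' z').
Proof.
move=> HR Rx Ry Rz; do 2?[apply: (cong_join HR)]; exact: (cong_meet HR).
Qed.

(** The majority of [(a, b)], [(a, c)] and [(a', c)] is [(a, c)], that of
    [(a', b')], [(a, c)] and [(a', c)] is [(a', c)]. *)
Lemma cong_prodl R a b a' b' c : lattice_congruence R ->
  R ((a, b) : A *p B) (a', b') -> R ((a, c) : A *p B) (a', c).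
Proof.
move=> HR Rab; have /= := cong_majority HR Rab
  (cong_refl HR ((a, c) : A *p B)) (cong_refl HR ((a', c) : A *p B)).
by rewrite !majority_prod /= !majority12 !majority23 majority13.
Qed.

Lemma cong_prodr R a b a' b' c : lattice_congruence R ->
  R ((a, b) : A *p B) (a', b') -> R ((c, b) : A *p B) (c, b').
Proof.
move=> HR Rab; have /= := cong_majority HR Rab
  (cong_refl HR ((c, b) : A *p B)) (cong_refl HR ((c, b') : A *p B)).
by rewrite !majority_prod /= !majority12 !majority23 majority13.
Qed.

Lemma Con_prod : Con (A *p B) #= Con A `*` Con B.
Proof.
pose f (R : A *p B -> A *p B -> Prop) :=
  ((fun a a' => R (a, b0) (a', b0)), (fun b b' => R (a0, b) (a0, b'))).
pose g (p : (A -> A -> Prop) * (B -> B -> Prop)) (x y : A *p B) :=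
  p.1 x.1 y.1 /\ p.2 x.2 y.2.
apply: (card_eq_can (f := f) (g := g)).
- move=> R HR; split=> /=; split; first split.
  + by move=> a; apply: cong_refl HR _.
  + by move=> a b; apply: cong_sym HR _ _.
  + by move=> a b c; apply: cong_trans HR _ _ _.
  + move=> a a' b b' ha hb; have := cong_meet HR ha hb.
    by rewrite !meetEprod /= meetxx.
  + move=> a a' b b' ha hb; have := cong_join HR ha hb.
    by rewrite !joinEprod /= joinxx.
  + split.
    * by move=> a; apply: cong_refl HR _.
    * by move=> a b; apply: cong_sym HR _ _.
    * by move=> a b c; apply: cong_trans HR _ _ _.
  + move=> a a' b b' ha hb; have := cong_meet HR ha hb.
    by rewrite !meetEprod /= meetxx.
  + move=> a a' b b' ha hb; have := cong_join HR ha hb.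
    by rewrite !joinEprod /= joinxx.
- move=> [RA RB] [/= HA HB]; rewrite /g /=; split; first split.
  + by move=> x; split; [apply: cong_refl HA _|apply: cong_refl HB _].
  + by move=> x y [??]; split; [apply: cong_sym HA _ _ _|apply: cong_sym HB _ _ _].
  + move=> x y z [??] [??]; split.
      by apply: (cong_trans HA (y := y.1)).
    by apply: (cong_trans HB (y := y.2)).
  + move=> x x' y y' [??] [??]; rewrite !meetEprod.
    by split; [apply: (cong_meet HA)|apply: (cong_meet HB)].
  + move=> x x' y y' [??] [??]; rewrite !joinEprod.
    by split; [apply: (cong_join HA)|apply: (cong_join HB)].
- move=> R HR; apply/funext => -[a b]; apply/funext => -[a' b'].
  apply/propext; rewrite /g /=; split=> [[ha hb]|h].
    apply: (cong_trans HR (y := (a', b))).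
      exact: cong_prodl HR ha.
    exact: cong_prodr HR hb.
  by split; [apply: cong_prodl HR h|apply: cong_prodr HR h].
- move=> [RA RB] [/= HA HB]; rewrite /f /g /=; congr pair.
    apply/funext => a; apply/funext => a'; apply/propext; split=> [[]//|].
    by split=> //; apply: cong_refl HB _.
  apply/funext => a; apply/funext => a'; apply/propext; split=> [[]//|].
  by split=> //; apply: cong_refl HA _.
Qed.

Lemma many_ideals_prod (K : Type) : infinite_set [set: K] ->
  many_ideals K A -> many_ideals K B -> many_ideals K (A *p B).
Proof.
move=> Kinf [dA_ /card_eqPle[AK KA] IA] [dB_ /card_eqPle[BK _] _].
split; first exact: dcc_prod.
  apply: Cantor_Bernstein; first exact: card_prod_le.
  apply: card_le_trans KA _; apply/card_leTP.
  by exists (fun a => (a, b0) : A *p B) => x y [].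
apply: (card_Id_embed (A := A) (f := fun a => (a, b0) : A *p B)) IA.
  by move=> x y; rewrite leEprod /= => /andP[].
by move=> x y; rewrite joinEprod /= joinxx.
Qed.

End Products.

(** * Identities and varieties *)

Definition models d (L : latticeType d) (F : fieldType) : Prop :=
  forall e, satisfies L e <-> forall V : lmodType F, satisfies (vs_Con V) e.

(** A variety is determined by its identities, so membership and generation both
    reduce to the comparison of identities. *)
Lemma models_variety p d (L : latticeType d) : models L (prime_field p) ->
  variety_p p L /\ generates L (variety_p p).
Proof.
move=> LF; have Lp : variety_p p L.
  move=> W [E EW] CW; apply/EW => e Ee; apply/LF => V.
  by have /EW := CW _ _ (vs_Con_class_intro V); apply.
split=> // d' M; split=> hM W Wvar CW.
  by apply: hM => // _ _ []; apply: Lp.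
have [E EW] := Wvar; apply: hM => // _ _ [V]; apply/EW => e Ee.
have /EW/(_ _ Ee)/LF := CW _ _ (singleton_class_self L); exact.
Qed.

Section Embedding.
Context {dA dB : Order.disp_t} (A : latticeType dA) (B : latticeType dB).
Variable f : A -> B.
Hypotheses (f_inj : injective f)
  (f_meet : forall x y, f (Order.meet x y) = Order.meet (f x) (f y))
  (f_join : forall x y, f (Order.join x y) = Order.join (f x) (f y)).

Lemma leval_embed v t : f (leval v t) = leval (f \o v) t.
Proof.
elim: t => [i|s IHs t IHt|s IHs t IHt] //=; first by rewrite f_meet IHs IHt.
by rewrite f_join IHs IHt.
Qed.

Lemma satisfies_embed e : satisfies B e -> satisfies A e.
Proof. by move=> Be v; apply: f_inj; rewrite !leval_embed. Qed.

End Embedding.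

(** * Finite subsets *)

Section FiniteSubsets.
Variable K : choiceType.

Definition finsubset : Type := {fset K}.
HB.instance Definition _ := Choice.on finsubset.

Implicit Types X Y Z : finsubset.
Local Open Scope fset_scope.

Definition fs_le X Y : bool := (X `<=` Y).
Definition fs_meet X Y : finsubset := X `&` Y.
Definition fs_join X Y : finsubset := X `|` Y.

Lemma fs_le_refl : reflexive fs_le.
Proof. by move=> X; apply: fsubset_refl. Qed.
Lemma fs_le_anti : antisymmetric fs_le.
Proof. by move=> X Y /andP[XY YX]; apply/eqP; rewrite eqEfsubset; apply/andP. Qed.
Lemma fs_le_trans : transitive fs_le.
Proof. by move=> X Y Z; apply: fsubset_trans. Qed.
Lemma fs_meetP X Y Z : fs_le X (fs_meet Y Z) = fs_le X Y && fs_le X Z.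
Proof. exact: fsubsetI. Qed.
Lemma fs_joinP X Y Z : fs_le (fs_join X Y) Z = fs_le X Z && fs_le Y Z.
Proof. exact: fsubUset. Qed.

Fact finsubset_display : Order.disp_t. Proof. exact: Order.Disp tt tt. Qed.

HB.instance Definition _ := Order.Le_isPOrder.Build finsubset_display finsubset
  fs_le_refl fs_le_anti fs_le_trans.
HB.instance Definition _ := Order.POrder_MeetJoin_isLattice.Build
  finsubset_display finsubset fs_meetP fs_joinP.

Lemma fs_meetUl : @left_distributive finsubset finsubset Order.meet Order.join.
Proof. by move=> X Y Z; apply: fsetIUl. Qed.

HB.instance Definition _ := Order.Lattice_Meet_isDistrLattice.Build
  finsubset_display finsubset fs_meetUl.

End FiniteSubsets.

Lemma dcc_rank d (L : latticeType d) (rank : L -> nat) :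
  (forall x y, (x <= y)%O -> rank y <= rank x -> x = y) -> dcc L.
Proof.
move=> rankP P [x0 Px0].
have ex : exists n, `[< exists2 x, P x & rank x = n >].
  by exists (rank x0); apply/asboolP; exists x0.
case: (ex_minnP ex) => n /asboolP[m Pm mn] nmin.
exists m => // x Px xm; apply: rankP => //.
by rewrite mn; apply: nmin; apply/asboolP; exists x.
Qed.

Section FiniteSubsetsTheory.
Variable K : choiceType.
Hypothesis K_infinite : infinite_set [set: K].
Local Open Scope fset_scope.
Implicit Types X Y Z : finsubset K.

Lemma finsubset_dcc : dcc (finsubset K).
Proof.
apply: (@dcc_rank _ _ (fun X : finsubset K => #|` (X : {fset K})|)) => X Y XY YX.
by apply/eqP; rewrite eqEfcard; apply/andP.
Qed.

Lemma finsubset_card : [set: finsubset K] #= [set: K].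
Proof.
apply: Cantor_Bernstein.
  apply: card_le_trans (card_seq_le K_infinite (card_lexx [set: K])).
  by apply/card_leTP; exists (fun X : finsubset K => enum_fset X) => X Y; apply: val_inj.
apply/card_leTP; exists (fun k => [fset k] : finsubset K) => x y /fsetP/(_ x).
by rewrite !inE eqxx => /esym/eqP.
Qed.

Lemma finsubset_Id : [set: set K] #<= Id (finsubset K).
Proof.
apply: (card_le_inj (f := fun A => [set X : finsubset K | forall k, k \in X -> A k])).
  move=> A _; split; first by exists fset0 => k; rewrite inE.
    by move=> X Y YA /fsubsetP XY k /XY /YA.
  by move=> X Y XA YA k; rewrite inE => /orP[/XA|/YA].
suff H (A B : set K) : [set X : finsubset K | forall k, k \in X -> A k] =
    [set X : finsubset K | forall k, k \in X -> B k] -> (A `<=` B)%classic.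
  by move=> A B _ _ e; apply/seteqP; split; apply: H.
move=> e k Ak; have /(_ k) : [set X : finsubset K | forall k, k \in X -> B k] [fset k].
  by rewrite -e => j; rewrite inE => /eqP ->.
by rewrite inE eqxx; apply.
Qed.

Lemma finsubset_many_ideals : many_ideals K (finsubset K).
Proof. by split; [exact: finsubset_dcc|exact: finsubset_card|exact: finsubset_Id]. Qed.

(** A congruence is determined by the atoms that it identifies with the empty
    set, since [X] is the join of [X `&` Y] and of finitely many atoms outside
    [Y]; and any set of atoms may be collapsed. *)
Lemma finsubset_Con : Con (finsubset K) #= [set: set K].
Proof.
pose f (R : finsubset K -> finsubset K -> Prop) : set K :=
  [set k | R fset0 [fset k]].
pose g (A : set K) X Y := forall k, ~ A k -> (k \in X) = (k \in Y).
apply: (card_eq_can (f := f) (g := g)) => //.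
- move=> A _; split; first split.
  + by [].
  + by move=> X Y XY k /XY ->.
  + by move=> X Y Z XY YZ k Ak; rewrite XY // YZ.
  + by move=> X X' Y Y' XX YY k Ak; rewrite !inE XX // YY.
  + by move=> X X' Y Y' XX YY k Ak; rewrite !inE XX // YY.
- move=> R HR; apply/funext => X; apply/funext => Y; apply/propext.
  split=> [XY|RXY k].
    have R0 Z : (forall k, k \in Z -> R fset0 [fset k]) -> R fset0 Z.
      elim/finSet_rect: (Z : {fset K}) => {}Z IH ZR.
      have [->|[k kZ]] := fset_0Vmem Z; first exact: cong_refl HR _.
      rewrite -(fsetD1K kZ); have <- : fset0 `|` fset0 = fset0 :> {fset K}.
        exact: fsetUid.
      apply: (cong_join HR); first exact: ZR.
      by apply: IH; [exact: fproperD1|move=> j; rewrite inE => /andP[_ /ZR]].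
    have RI Z W : (forall k, ~ R fset0 [fset k] -> (k \in Z) = (k \in W)) ->
        R (Z `&` W) Z.
      move=> ZW; rewrite -{2}(fsetID W Z) -{1}(fsetU0 (Z `&` W)).
      apply: (cong_joinl HR); apply: R0 => k; rewrite inE => /andP[kW kZ].
      by apply: contrapT => /ZW; rewrite kZ (negPf kW).
    apply: (cong_trans HR (y := X `&` Y)); first exact/(cong_sym HR)/RI.
    by rewrite fsetIC; apply: RI => k /XY ->.
  have RI Z W : R Z W -> k \in Z -> k \notin W -> R fset0 [fset k].
    move=> RZW kZ kW; apply: (cong_sym HR).
    have := cong_meet HR RZW (cong_refl HR ([fset k] : finsubset K)).
    rewrite [Order.meet Z _](fsetIidPr _) ?fsub1set//.
    by rewrite [Order.meet W _](fsetI1) (negPf kW).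
  move=> nR; apply/idP/idP => kX; apply: contrapT => /negP kY; apply: nR.
    exact: RI RXY kX kY.
  by apply: RI kX kY; apply: cong_sym.
- move=> A _; apply/seteqP; split=> k.
    move=> h; apply: contrapT => /h; by rewrite !inE eqxx.
  by move=> Ak j nAj; rewrite !inE; apply/esym/eqP => jk; rewrite jk in nAj.
Qed.

End FiniteSubsetsTheory.

(** * Finitely generated subspaces *)

Section Subspaces.
Variables (F : fieldType) (V : lmodType F).
Local Open Scope ring_scope.
Implicit Types (W X Y : set V) (s t : seq V).

Definition subspace W : Prop :=
  [/\ W 0, forall u v, W u -> W v -> W (u + v)
    & forall a u, W u -> W (a *: u)].

Fixpoint span s : set V :=
  if s is x :: s' then [set v | exists c, exists2 u, span s' u & v = c *: x + u]
  else [set 0].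

Definition sumset X Y : set V :=
  [set v | exists x, exists2 y, X x /\ Y y & v = x + y].

Lemma subspaceB W u v : subspace W -> W u -> W v -> W (u - v).
Proof. by move=> [_ WD WZ] Wu Wv; rewrite -scaleN1r; apply/WD/WZ. Qed.

Lemma subspaceZ_inv W a u : subspace W -> a != 0 -> W (a *: u) -> W u.
Proof. by move=> [_ _ WZ] a0 /(WZ a^-1); rewrite scalerA mulVf ?scale1r. Qed.

Lemma span_subspace s : subspace (span s).
Proof.
elim: s => [|x s [s0 sD sZ]] /=; split=> //=.
- by move=> u v -> ->; rewrite addr0.
- by move=> a u ->; rewrite scaler0.
- by exists 0, 0 => //; rewrite scale0r addr0.
- move=> u v [a [u' su ->]] [b [v' sv ->]]; exists (a + b), (u' + v').
    exact: sD.
  by rewrite scalerDl addrACA.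
- move=> a u [b [u' su ->]]; exists (a * b), (a *: u'); first exact: sZ.
  by rewrite scalerDr scalerA.
Qed.

Lemma span_tail x s : span s `<=` span (x :: s).
Proof. by move=> v sv; exists 0, v => //; rewrite scale0r add0r. Qed.

Lemma span_head x s : span (x :: s) x.
Proof. by exists 1, 0; [case: (span_subspace s)|rewrite scale1r addr0]. Qed.

Lemma mem_span s x : x \in s -> span s x.
Proof.
elim: s => // y s IH; rewrite inE => /predU1P[->|/IH]; first exact: span_head.
exact: span_tail.
Qed.

Lemma span_min s W : subspace W -> (forall x, x \in s -> W x) -> span s `<=` W.
Proof.
move=> [W0 WD WZ]; elim: s => [|x s IH] sW /= v; first by move=> ->.
move=> [c [u su ->]]; apply: WD; first by apply/WZ/sW/mem_head.
by apply: IH su => y ys; apply: sW; rewrite inE ys orbT.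
Qed.

Lemma sumset_subspace X Y : subspace X -> subspace Y -> subspace (sumset X Y).
Proof.
move=> [X0 XD XZ] [Y0 YD YZ]; split.
- by exists 0, 0 => //; rewrite addr0.
- move=> _ _ [x [y [Xx Yy] ->]] [x' [y' [Xx' Yy'] ->]].
  by exists (x + x'), (y + y'); [split; [apply: XD|apply: YD]|rewrite addrACA].
- move=> a _ [x [y [Xx Yy] ->]]; exists (a *: x), (a *: y).
    by split; [apply: XZ|apply: YZ].
  by rewrite scalerDr.
Qed.

Lemma setI_subspace X Y : subspace X -> subspace Y -> subspace (X `&` Y).
Proof.
move=> [X0 XD XZ] [Y0 YD YZ]; split=> //.
  by move=> u v [? ?] [? ?]; split; [apply: XD|apply: YD].
by move=> a u [? ?]; split; [apply: XZ|apply: YZ].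
Qed.

Lemma sumset_subl X Y : subspace Y -> X `<=` sumset X Y.
Proof. by move=> [Y0 _ _] x Xx; exists x, 0 => //; rewrite addr0. Qed.

Lemma sumset_subr X Y : subspace X -> Y `<=` sumset X Y.
Proof. by move=> [X0 _ _] x Xx; exists 0, x => //; rewrite add0r. Qed.

Lemma sumset_min X Y W :
  subspace W -> X `<=` W -> Y `<=` W -> sumset X Y `<=` W.
Proof. by move=> [_ WD _] XW YW _ [x [y [/XW Wx /YW Wy] ->]]; apply: WD. Qed.

Lemma span_cat s t : span (s ++ t) = sumset (span s) (span t).
Proof.
apply/seteqP; split.
  apply: span_min; first by apply: sumset_subspace; apply: span_subspace.
  move=> x; rewrite mem_cat => /orP[/mem_span xs|/mem_span xt].
    by apply: sumset_subl xs; apply: span_subspace.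
  by apply: sumset_subr xt; apply: span_subspace.
apply: sumset_min; first exact: span_subspace.
  by apply: span_min => [|x xs]; [apply: span_subspace|apply: mem_span];
    rewrite mem_cat xs.
by apply: span_min => [|x xs]; [apply: span_subspace|apply: mem_span];
  rewrite mem_cat xs orbT.
Qed.

(** Exchange: if some [w] in [W] involves the first generator, then [w] can
    replace it, and the rest of [W] lies in the span of the tail. The last clause
    makes the least size of a generating list a strictly monotone rank. *)
Lemma sub_span W s : subspace W -> W `<=` span s ->
  exists t, [/\ W = span t, (size t <= size s)%N
              & size t = size s -> span s `<=` W].
Proof.
elim: s W => [|x s IH] W HW Ws.
  exists [::]; split=> //; last by move=> _ v /= ->; case: HW.
  by apply/seteqP; split=> // v /= ->; case: HW.
have [Ws'|] := pselect (W `<=` span s).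
  have [t [Wt ts _]] := IH W HW Ws'; exists t; split=> //.
    exact: leqW.
  by move=> e; rewrite e /= ltnn in ts.
move=> /existsNP[w /not_implyP[Ww ws]].
have [c [u su wE]] := Ws _ Ww.
have c0 : c != 0.
  by apply: contra_notN ws => /eqP c0; rewrite wE c0 scale0r add0r.
have HWs : subspace (W `&` span s) by apply: setI_subspace => //; apply: span_subspace.
have [t [tE ts tS]] := IH _ HWs (@subIsetr _ W (span s)).
have [W0 WD WZ] := HW; have [s0 sD sZ] := span_subspace s.
exists (w :: t); split=> //=; last first.
  move=> [/tS sW] _ [a [v sv ->]]; apply: WD; last by have [] := sW _ sv.
  apply: WZ; apply: (subspaceZ_inv HW c0).
  have -> : c *: x = w - u by rewrite wE addrK.
  by apply: subspaceB => //; have [] := sW _ su.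
apply/seteqP; split=> v.
  move=> Wv; have [a [v' sv' vE]] := Ws _ Wv.
  exists (a / c), (v - (a / c) *: w); last by rewrite addrC subrK.
  rewrite -tE; split; first by apply: subspaceB => //; apply: WZ.
  rewrite vE wE scalerDr scalerA divfK // opprD addrACA subrr add0r.
  by apply: subspaceB; [apply: span_subspace| |apply: sZ].
by rewrite -tE => -[a [v' [Wv' _] ->]]; apply: WD => //; apply: WZ.
Qed.

(** The lattices with two and with three congruences differ only by the top
    element that [b] switches on; modularity, chain condition and identities are
    common to them. *)
Record fgsub (b : bool) : Type := FgSub {
  fg_set :> set V;
  fg_setP : (exists s, fg_set = span s) \/ (b /\ fg_set = setT)
}.

Section FgSub.
Variable b : bool.
HB.instance Definition _ := gen_eqMixin (fgsub b).
HB.instance Definition _ := gen_choiceMixin (fgsub b).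
Implicit Types A B C : fgsub b.

Lemma fg_ext A B : A = B :> set V -> A = B.
Proof.
by case: A B => [A hA] [B hB] /= e; case: _ / e hB => hB; congr FgSub.
Qed.

Lemma fg_subspace A : subspace A.
Proof. by case: A => _ /= [[s ->]|[_ ->]]; [exact: span_subspace|]. Qed.

Lemma fg_setI A B : (exists s, A `&` B = span s) \/ (b /\ A `&` B = setT).
Proof.
have HAB := setI_subspace (fg_subspace A) (fg_subspace B).
case: (fg_setP A) => [[s As]|[_ AT]].
  left; have [|t [-> _ _]] := @sub_span _ s HAB; last by exists t.
  by rewrite -As; apply: subIsetl.
by rewrite AT setTI; exact: fg_setP.
Qed.

Lemma fg_sumset A B :
  (exists s, sumset A B = span s) \/ (b /\ sumset A B = setT).
Proof.
case: (fg_setP A) => [[s As]|[bT AT]]; last first.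
  right; split=> //; apply/seteqP; split=> // v _.
  by apply: sumset_subl; [exact: fg_subspace|rewrite AT].
case: (fg_setP B) => [[t Bt]|[bT BT]].
  by left; exists (s ++ t); rewrite span_cat As Bt.
right; split=> //; apply/seteqP; split=> // v _.
by apply: sumset_subr; [exact: fg_subspace|rewrite BT].
Qed.

Definition fg_le A B : bool := `[< A `<=` B >].
Definition fg_meet A B : fgsub b := FgSub (fg_setI A B).
Definition fg_join A B : fgsub b := FgSub (fg_sumset A B).

Lemma fg_le_refl : reflexive fg_le.
Proof. by move=> A; apply/asboolP. Qed.

Lemma fg_le_anti : antisymmetric fg_le.
Proof.
by move=> A B /andP[/asboolP AB /asboolP BA]; apply/fg_ext/seteqP.
Qed.

Lemma fg_le_trans : transitive fg_le.
Proof.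
by move=> B A C /asboolP AB /asboolP BC; apply/asboolP; apply: subset_trans BC.
Qed.

Lemma fg_meetP A B C : fg_le A (fg_meet B C) = fg_le A B && fg_le A C.
Proof.
apply/asboolP/andP => [h|[/asboolP AB /asboolP AC]].
  by split; apply/asboolP => v /h[].
by move=> v Av; split; [apply: AB|apply: AC].
Qed.

Lemma fg_joinP A B C : fg_le (fg_join A B) C = fg_le A C && fg_le B C.
Proof.
apply/asboolP/andP => [h|[/asboolP AC /asboolP BC]]; last first.
  exact: sumset_min (fg_subspace C) AC BC.
split; apply/asboolP; apply: subset_trans h.
  exact/sumset_subl/fg_subspace.
exact/sumset_subr/fg_subspace.
Qed.

Fact fg_display : Order.disp_t. Proof. exact: Order.Disp tt tt. Qed.

HB.instance Definition _ := Order.Le_isPOrder.Build fg_display (fgsub b)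
  fg_le_refl fg_le_anti fg_le_trans.
HB.instance Definition _ := Order.POrder_MeetJoin_isLattice.Build
  fg_display (fgsub b) fg_meetP fg_joinP.

Lemma fg_leP A B : reflect (A `<=` B) (A <= B)%O.
Proof. exact: asboolP. Qed.

Lemma fg_meetE A B : Order.meet A B = A `&` B :> set V.
Proof. by []. Qed.

Lemma fg_joinE A B : Order.join A B = sumset A B :> set V.
Proof. by []. Qed.

Definition fin s : fgsub b := FgSub (or_introl (ex_intro _ s erefl)).

Lemma fin_cat s t : fin (s ++ t) = Order.join (fin s) (fin t).
Proof. by apply: fg_ext; rewrite fg_joinE /= span_cat. Qed.

Lemma fin_le s A : (forall x, x \in s -> (A : set V) x) -> (fin s <= A)%O.
Proof. by move=> sA; apply/fg_leP; apply: span_min sA; apply: fg_subspace. Qed.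

Lemma fg_modular : modular (fgsub b).
Proof.
move=> A B C /fg_leP AC; apply/fg_ext; rewrite !(fg_meetE, fg_joinE).
have HC := fg_subspace C; have [_ CD _] := HC.
apply/seteqP; split=> v.
  move=> [x [y [Ax [By Cy]] ->]]; split; first by exists x, y.
  by apply: CD => //; apply: AC.
move=> [[x [y [Ax By] vE]] Cv]; exists x, y => //; split=> //; split=> //.
have -> : y = v - x by rewrite vE addrC addKr.
by apply: subspaceB => //; apply: AC.
Qed.

(** Among the finitely generated members one of least rank is minimal; if there
    are none, the whole space is the only member. *)
Lemma fg_dcc : dcc (fgsub b).
Proof.
move=> P [A0 PA0].
have [[A [PA [s As]]]|Pinf] :=
    pselect (exists A, P A /\ exists s, A = span s :> set V); last first.
  have E A : P A -> A = setT :> set V.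
    by move=> PA; case: (fg_setP A) => [As|[]//]; case: Pinf; exists A.
  by exists A0 => // A PA _; apply: fg_ext; rewrite !E.
have ex : exists n, `[< exists A s, [/\ P A, A = span s :> set V & size s = n] >].
  by exists (size s); apply/asboolP; exists A, s.
case: (ex_minnP ex) => n /asboolP[B [t [PB Bt tn]]] nmin.
exists B => // C PC /fg_leP CB; have HC := fg_subspace C.
have [|r [Cr rt rS]] := @sub_span C t HC; first by rewrite -Bt.
apply/fg_ext/seteqP; split=> //; rewrite Bt; apply: rS.
apply/eqP; rewrite eqn_leq rt tn; apply: nmin; apply/asboolP.
by exists C, r.
Qed.

(** A vector [v] in only one of two related subspaces gives a collapsed line
    [Fv]. Any other line [Fw] is then collapsed as well, since [F(v + w)] is a
    common complement of [Fv] and [Fw] in their join. *)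
Lemma fg_cong_collapse R A B s t : lattice_congruence R -> R A B -> A <> B ->
  R (fin s) (fin t).
Proof.
move=> HR RAB AB.
have [v v0 Rv] : exists2 v, v <> 0 & R (fin [::]) (fin [:: v]).
  wlog [v Bv Av] : A B RAB {AB} / exists2 v : V, (B : set V) v & ~ (A : set V) v.
    move=> IH; have [[v Bv Av]|BA] :=
        pselect (exists2 v : V, (B : set V) v & ~ (A : set V) v).
      by apply: (IH A B) => //; exists v.
    apply: (IH B A); first exact: cong_sym HR _ _ RAB.
    apply: contrapT => nAB; apply: AB; apply/fg_ext/seteqP; split=> v h.
      by apply: contrapT => h'; apply: nAB; exists v.
    by apply: contrapT => h'; apply: BA; exists v.
  have [A0 AD AZ] := fg_subspace A; have [B0 BD BZ] := fg_subspace B.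
  exists v; first by move=> v0; rewrite v0 in Av.
  have := cong_meet HR RAB (cong_refl HR (fin [:: v])).
  have -> : Order.meet A (fin [:: v]) = fin [::].
    apply/fg_ext/seteqP; rewrite fg_meetE /=; split=> u.
      move=> [Au [c [_ -> uE]]] /=; rewrite uE addr0 in Au *.
      have [->|c0] := eqVneq c 0; first by rewrite scale0r.
      by case: Av; apply: subspaceZ_inv c0 Au; apply: fg_subspace.
    by move=> /= ->; split=> //; case: (span_subspace [:: v]).
  have -> // : Order.meet B (fin [:: v]) = fin [:: v].
  apply/fg_ext/seteqP; rewrite fg_meetE /=; split=> u; first by case.
  by move=> [c [_ -> ->]]; split; [rewrite addr0; apply: BZ|exists c, 0].
have Rline w : R (fin [::]) (fin [:: w]).
  have [[c [_ -> wE]]|wv] := pselect (span [:: v] w).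
    apply: (cong_convex HR Rv) => //; apply: fin_le => // x /[!inE] /eqP->.
    by exists c, 0.
  have := cong_joinl HR (fin [:: v + w]) Rv.
  move=> /(cong_meetl HR (fin [:: w])).
  have -> : Order.meet (fin [:: w]) (Order.join (fin [:: v + w]) (fin [::])) = fin [::].
    rewrite -fin_cat cats0; apply/fg_ext/seteqP; rewrite fg_meetE /=; split=> u.
      move=> [[a [_ -> ->]] [c [_ -> ]]]; rewrite !addr0 scalerDr.
      move=> e; have {}e : (a - c) *: w = c *: v by rewrite scalerBl e addrK.
      have [ac|ac] := eqVneq (a - c) 0; last first.
        case: wv; apply: (subspaceZ_inv _ ac); first exact: span_subspace.
        by rewrite e; exists c, 0 => //; rewrite addr0.
      move: e; rewrite ac scale0r => /esym/eqP.
      rewrite scaler_eq0 => /orP[/eqP c0|/eqP//].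
      by move: ac; rewrite c0 subr0 => ->; rewrite scale0r.
    move=> /= ->; split; first by case: (span_subspace [:: w]).
    by case: (span_subspace [:: v + w]).
  rewrite -fin_cat meet_l //; apply: fin_le => x /[!inE] /eqP->.
  exists 1, (- v); last by rewrite scale1r addrC addKr.
  by exists (-1), 0 => //; rewrite scaleN1r addr0.
have Rfin r : R (fin [::]) (fin r).
  elim: r => [|x r IH]; first exact: cong_refl HR _.
  rewrite -cat1s fin_cat; have -> : fin [::] = Order.join (fin [::]) (fin [::]).
    by rewrite joinxx.
  exact: cong_join.
exact: cong_trans HR _ _ _ (cong_sym HR (Rfin s)) (Rfin t).
Qed.

End FgSub.

Lemma fgsub_false A : exists s, A = fin false s.
Proof. by case: (fg_setP A) => [[s As]|[]//]; exists s; apply: fg_ext. Qed.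

(** Extend the lower bound greedily by those generators of the upper one that
    do not already lie in the join with [X]. *)
Lemma fg_complement (A B X : fgsub false) : A `<=` X -> X `<=` B ->
  exists Y : fgsub false, X `&` Y = A /\ sumset X Y = B.
Proof.
move=> AX XB; have [s BE] := fgsub_false B.
have HX := fg_subspace X; have HA := fg_subspace A.
suff [Y [AY YB XYA sXY]] : exists Y : fgsub false, [/\ A `<=` Y, Y `<=` B,
    X `&` Y = A & forall x, x \in s -> sumset X Y x].
  exists Y; split=> //; apply/seteqP; split.
    by apply: sumset_min => //; apply: fg_subspace.
  rewrite BE; apply: span_min => //.
  by apply: sumset_subspace => //; apply: fg_subspace.
have sB x : x \in s -> (B : set V) x by rewrite BE; apply: mem_span.
elim: s sB {BE} => [|x s IH] sB.
  by exists A; split=> //; [exact: (subset_trans AX XB)|exact/setIidr].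
have [|Y [AY YB XYA sXY]] := IH; first by move=> y ys; apply: sB; rewrite inE ys orbT.
have [xXY|xXY] := pselect (sumset X Y x).
  by exists Y; split=> // y; rewrite inE => /predU1P[->|/sXY].
have [X0 XD XZ] := HX; have HY := fg_subspace Y; have [Y0 YD YZ] := HY.
have H := span_subspace [:: x].
exists (Order.join Y (fin false [:: x])); split.
- by apply: subset_trans AY _; apply: sumset_subl.
- apply: sumset_min => //; first exact: fg_subspace.
  apply: span_min; first exact: fg_subspace.
  by move=> z /[!inE] /eqP->; apply: sB; apply: mem_head.
- apply/seteqP; split=> v; last first.
    by rewrite -XYA => -[Xv Yv]; split=> //; apply: sumset_subl.
  rewrite fg_joinE -XYA => -[Xv [y [_ [Yy [c [_ -> ->]]] vE]]]; split=> //.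
  rewrite addr0 in vE; have [c0|c0] := eqVneq c 0.
    by rewrite vE c0 scale0r addr0.
  case: xXY; apply: (subspaceZ_inv _ c0); first exact: sumset_subspace.
  exists v, (- y); last by rewrite vE addrC addKr.
  by split=> //; rewrite -scaleN1r; apply: YZ.
- move=> z; rewrite inE => /predU1P[->|/sXY].
    apply: sumset_subr => //; apply: sumset_subr => //; exact: span_head.
  move=> [u [w [Xu Yw] ->]]; exists u, w => //; split=> //.
  exact: sumset_subl.
Qed.

Lemma fg_relatively_complemented : relatively_complemented (fgsub false).
Proof.
move=> A B X /fg_leP AX /fg_leP XB; have [Y [XYA XYB]] := fg_complement AX XB.
by exists Y; split; apply: fg_ext.
Qed.

End Subspaces.

(** * Finitely supported vectors *)

Section FiniteSupport.
Variables (K : choiceType) (F : fieldType).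
Local Open Scope ring_scope.

(** Finite supports keep the space as small as [K] and its finitely generated
    subspaces proper. *)
Definition finite_support : {pred K -> F^o} :=
  fun f => `[< finite_set [set k | f k <> 0] >].

Lemma finite_support_submod : GRing.submod_closed finite_support.
Proof.
split.
  apply/asboolP; rewrite (_ : [set _ | _] = set0); first exact: finite_set0.
  by apply/seteqP; split=> k //=; case.
move=> a f g /asboolP ff /asboolP gf; apply/asboolP.
have : finite_set ([set k | f k <> 0] `|` [set k | g k <> 0]).
  by rewrite finite_setU.
apply: sub_finite_set => k /= fgk.
have [fk|fk] := pselect (f k = 0); last by left.
have [gk|gk] := pselect (g k = 0); last by right.
case: fgk; rewrite (_ : (a *: f + g) k = a * f k + g k) //.
by rewrite fk gk mulr0 addr0.
Qed.

HB.instance Definition _ := GRing.isSubmodClosed.Build F (K -> F^o)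
  finite_support finite_support_submod.

Record finvect := FinVect {
  finvect_fun :> K -> F^o;
  finvectP : finvect_fun \in finite_support
}.

HB.instance Definition _ := [isSub for finvect_fun].
HB.instance Definition _ := [Choice of finvect by <:].
HB.instance Definition _ := [SubChoice_isSubLmodule of finvect by <:].

Implicit Types u v : finvect.

Lemma finvect_ext u v : u =1 v -> u = v.
Proof. by move=> uv; apply/val_inj/funext. Qed.

Lemma finvectD u v k : (u + v) k = u k + v k. Proof. by []. Qed.
Lemma finvectZ (a : F) v k : (a *: v) k = a * v k. Proof. by []. Qed.
Lemma finvect0 k : (0 : finvect) k = 0. Proof. by []. Qed.

Definition unitvect_fun (k : K) : K -> F^o := fun j => (k == j)%:R.

Lemma unitvect_finite k : unitvect_fun k \in finite_support.
Proof.
apply/asboolP; apply: (sub_finite_set _ (finite_set1 k)) => j /=.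
by rewrite /unitvect_fun; have [->|] := eqVneq k j.
Qed.

Definition unitvect k : finvect := FinVect (unitvect_finite k).

Lemma unitvectE k j : unitvect k j = (k == j)%:R. Proof. by []. Qed.

Lemma finvect_card : infinite_set [set: K] -> countable [set: F] ->
  [set: finvect] #<= [set: K].
Proof.
move=> Kinf Fcount.
have := card_seq_le Kinf (card_prod_le Kinf (card_lexx [set: K])
  (card_le_trans Fcount (card_nat_le Kinf))).
apply: card_le_trans; apply/card_leTP.
have supp v : finite_set [set k | v k <> 0] by apply/asboolP/finvectP.
exists (fun v => [seq (k, v k) | k <- enum_fset (fset_set [set k | v k <> 0])]).
move=> u v uv; apply: finvect_ext => k; apply: contrapT => uvk.
wlog uk : u v uv uvk / u k <> 0.
  move=> IH; have [uk|uk] := pselect (u k = 0); last exact: (IH u v).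
  by apply: (IH v u) => //; [apply: nesym|rewrite -uk; apply: nesym].
have : (k, u k) \in [seq (k, u k) | k <- enum_fset (fset_set [set k | u k <> 0])].
  by apply: map_f; rewrite in_fset_set //; apply/mem_set.
by rewrite uv => /mapP[j _ [<-]].
Qed.

End FiniteSupport.

Section FgVectors.
Variables (K : choiceType) (F : fieldType) (b : bool).
Hypotheses (K_infinite : infinite_set [set: K]) (F_count : countable [set: F]).
Local Open Scope ring_scope.
Local Notation V := (finvect K F).
Local Notation L := (fgsub V b).
Local Notation fin := (@fin F V b).

Lemma unitvect_line (k j : K) : span [:: unitvect F k] (unitvect F j) -> k = j.
Proof.
move=> [c [_ -> /(congr1 (fun v : V => v j))]].
rewrite addr0 finvectZ !unitvectE eqxx.
by have [//|_ /eqP] := eqVneq k j; rewrite mulr0 oner_eq0.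
Qed.

Lemma unitvect_neq0 (k : K) : unitvect F k <> 0.
Proof.
move=> /(congr1 (fun v : V => v k)); rewrite unitvectE eqxx finvect0.
by move/eqP; rewrite oner_eq0.
Qed.

Lemma fin_proper s : fin s <> setT :> set V.
Proof.
move=> sT; have [k ks] : exists k, forall v : V, v \in s -> v k = 0.
  have : finite_set (\bigcup_(v in [set` s]) [set k | (v : V) k <> 0]).
    apply: bigcup_finite; first exact: finite_seq.
    by move=> v _; apply/asboolP/finvectP.
  move=> fins; apply: contrapT => nk; apply: K_infinite.
  apply: sub_finite_set fins => k _; apply: contrapT => kn; apply: nk.
  exists k => v vs; apply: contrapT => vk; apply: kn.
  by exists v.
have : span s `<=` [set v : V | v k = 0].
  apply: span_min; last exact: ks.
  split=> // [u v uk vk|a u uk]; rewrite /mkset.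
    by rewrite finvectD uk vk addr0.
  by rewrite finvectZ uk mulr0.
move=> sV; have : span s (unitvect F k) by rewrite -[span s]/(fin s : set V) sT.
by move=> /sV; rewrite /mkset unitvectE eqxx => /eqP; rewrite oner_eq0.
Qed.

Lemma fg_card : [set: L] #= [set: K].
Proof.
apply: Cantor_Bernstein.
  have := card_option_le K_infinite
    (card_seq_le K_infinite (finvect_card K_infinite F_count)).
  apply: card_le_trans; apply/card_leTP.
  have /choice[r rP] : forall A : L, exists o : option (seq V),
      A = (if o is Some s then span s else setT) :> set V.
    by move=> A; case: (fg_setP A) => [[s As]|[_ AT]]; [exists (Some s)|exists None].
  by exists r => A B AB; apply: fg_ext; rewrite !rP AB.
apply/card_leTP; exists (fun k => fin [:: unitvect F k]) => k j kj.
apply: unitvect_line; rewrite -[span _]/(fin _ : set V) kj.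
exact: span_head.
Qed.

(** Every set of coordinates gives the ideal of the subspaces supported on it,
    and its unit vectors tell it apart from the others. *)
Lemma fg_Id : [set: set K] #<= Id L.
Proof.
pose f (A : set K) := [set X : L |
  forall v : V, (X : set V) v -> forall k, ~ A k -> v k = 0].
apply: (card_le_inj (f := f)).
  move=> A _; split.
  - by exists (fin [::]) => v /= -> k _.
  - by move=> X Y YA /fg_leP XY v /XY /YA.
  - move=> X Y XA YA v; rewrite fg_joinE => -[x [y [Xx Yy] ->]] k Ak.
    by rewrite finvectD (XA x) // (YA y) // addr0.
suff H (A B : set K) : f A = f B -> A `<=` B.
  by move=> A B _ _ e; apply/seteqP; split; apply: H.
move=> e k Ak; apply: contrapT => nBk.
have : f A (fin [:: unitvect F k]).
  move=> _ [c [_ -> ->]] j Aj; rewrite addr0 finvectZ unitvectE.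
  by have [kj|] := eqVneq k j; [rewrite -kj in Aj|rewrite mulr0].
rewrite e => /(_ (unitvect F k) (span_head _ _) k nBk) /eqP.
by rewrite unitvectE eqxx oner_eq0.
Qed.

Lemma fg_many_ideals : many_ideals K L.
Proof. by split; [exact: fg_dcc|exact: fg_card|exact: fg_Id]. Qed.

(** Subspaces of an arbitrary space [U] are pulled back along a linear map
    [phi : V -> U], inside a fixed finitely generated subspace of [V]. *)
Section Pullback.
Variables (U : lmodType F) (phi : {linear V -> U}) (s : seq V).
Implicit Types (R : vs_Con U) (y : V).

Lemma ker_subspace R : subspace [set u | R u 0].
Proof.
have [[rR sR tR] aR zR] := vs_relP R; split=> //=.
  by move=> u v Ru Rv; have := aR _ _ _ _ Ru Rv; rewrite addr0.
by move=> a u Ru; have := zR a _ _ Ru; rewrite scaler0.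
Qed.

Lemma vs_relE R u v : R u v <-> R (u - v) 0.
Proof.
have [[rR _ _] aR zR] := vs_relP R; split=> h.
  by have := aR _ _ _ _ h (rR (- v)); rewrite subrr.
by have := aR _ _ _ _ h (rR v); rewrite subrK add0r.
Qed.

Lemma vs_of_subspace_proof (W : set U) : subspace W ->
  vs_congruence (fun u v => W (u - v)).
Proof.
move=> HW; have [W0 WD WZ] := HW; split; first split.
- by move=> u; rewrite subrr.
- by move=> u v /(WZ (-1)); rewrite scaleN1r opprB.
- by move=> u v w uv vw; have := WD _ _ uv vw; rewrite addrA subrK.
- by move=> u u' v v' /WD h /h; rewrite opprD addrACA.
- by move=> a u u' /(WZ a); rewrite scalerBr.
Qed.

Definition vs_of_subspace W (HW : subspace W) : vs_Con U :=
  VsCon (vs_of_subspace_proof HW).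

Lemma ker_meet R S u : (Order.meet R S) u 0 <-> R u 0 /\ S u 0.
Proof.
rewrite -[Order.meet R S]/(vs_meet R S) /=.
split=> [h|[Ru Su] T [->|->] //].
by split; apply: h; [left|right].
Qed.

Lemma ker_join R S u : (Order.join R S) u 0 <->
  exists x, exists2 y, R x 0 /\ S y 0 & u = x + y.
Proof.
rewrite -[Order.join R S]/(vs_join R S); split.
  have H := sumset_subspace (ker_subspace R) (ker_subspace S).
  move=> /(_ (vs_of_subspace H)); rewrite /= subr0; apply.
  split; apply/asboolP => x y /vs_relE xy /=.
    by apply: sumset_subl; [exact: ker_subspace|].
  by apply: sumset_subr; [exact: ker_subspace|].
move=> [x [y [Rx Sy] ->]] T [/asboolP RT /asboolP ST].
by case: (ker_subspace T) => _ TD _; apply: TD; [apply: RT|apply: ST].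
Qed.

Lemma pull_subspace R : subspace (span s `&` [set y | R (phi y) 0]).
Proof.
apply: setI_subspace; first exact: span_subspace.
case: (ker_subspace R) => R0 RD RZ; split=> /=; first by rewrite linear0.
  by move=> u v Ru Rv; rewrite linearD; apply: RD.
by move=> a u Ru; rewrite linearZ; apply: RZ.
Qed.

Lemma pull_finite R :
  (exists t, span s `&` [set y | R (phi y) 0] = span t) \/
  (b /\ span s `&` [set y | R (phi y) 0] = setT).
Proof.
have [t [-> _ _]] := sub_span (pull_subspace R) (@subIsetl _ (span s) _).
by left; exists t.
Qed.

Definition pull R : L := FgSub (pull_finite R).

Lemma pull_leval (v : nat -> vs_Con U) t y :
  (leval (fun i => pull (v i)) t : set V) y -> leval v t (phi y) 0.
Proof.
elim: t y => [i|t IHt r IHr|t IHt r IHr] y /=; first by case.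
  by move=> [/IHt ht /IHr hr]; apply/ker_meet.
move=> [x [z [/IHt ht /IHr hr] ->]]; apply/ker_join.
by exists (phi x), (phi z); rewrite ?linearD.
Qed.

End Pullback.

(** Membership of [x] in the value of a term has a finite witness, the list of
    the summands chosen at its joins; as soon as [phi] reaches these summands,
    the membership lifts along [phi]. *)
Lemma leval_pull (U : lmodType F) (v : nat -> vs_Con U) t (x : U) :
  leval v t x 0 -> exists l : seq U, forall (phi : {linear V -> U}) s,
    (forall u, u \in l -> exists2 y, span s y & phi y = u) ->
    forall y, span s y -> phi y = x ->
    (leval (fun i => pull phi s (v i)) t : set V) y.
Proof.
elim: t x => [i|t IHt r IHr|t IHt r IHr] x /=.
- by move=> vx; exists [::] => phi s _ y sy yx; split=> //=; rewrite yx.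
- move=> /ker_meet[/IHt[l hl] /IHr[l' hl']]; exists (l ++ l') => phi s ll y sy yx.
  by split; [apply: hl|apply: hl'] => // u ul; apply: ll; rewrite mem_cat ul ?orbT.
- move=> /ker_join[x1 [x2 [/IHt[l hl] /IHr[l' hl']] xE]].
  exists (x1 :: l ++ l') => phi s ll y sy yx.
  have [y1 sy1 yx1] := ll x1 (mem_head _ _).
  exists y1, (y - y1); last by rewrite addrC subrK.
  split.
    by apply: hl => // u ul; apply: ll; rewrite inE mem_cat ul orbT.
  apply: hl'; last by rewrite linearB yx yx1 xE addrC addKr.
    by move=> u ul; apply: ll; rewrite inE mem_cat ul !orbT.
  by apply: subspaceB => //; apply: span_subspace.
Qed.

Section Coordinates.
Variables (U : lmodType F) (l : seq U) (nu : nat -> K).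
Hypothesis nuI : injective nu.

Definition combine (y : V) : U := \sum_(i < size l) (y (nu i) : F) *: l`_i.

Lemma combine_linear : linear combine.
Proof.
move=> a x y; rewrite /combine scaler_sumr -big_split; apply: eq_bigr => i _.
by rewrite finvectD finvectZ scalerDl scalerA.
Qed.

HB.instance Definition _ :=
  GRing.isLinear.Build F V U _ combine combine_linear.

Lemma combine_unitvect i : (i < size l)%N -> combine (unitvect F (nu i)) = l`_i.
Proof.
move=> il; rewrite /combine (bigD1 (Ordinal il)) // unitvectE eqxx scale1r.
rewrite big1 => [|j ji]; first exact: addr0.
rewrite unitvectE (inj_eq nuI).
by rewrite -val_eqE /= eq_sym in ji; rewrite (negPf ji) scale0r.
Qed.

End Coordinates.

(** For [x] in the value of the left term, [leval_pull] provides finitely many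
    vectors; with [phi] mapping unit vectors onto them and onto [x], the identity
    among finitely generated subspaces puts [x] in the value of the right term. *)
Lemma fg_satisfies_Con e (U : lmodType F) : satisfies L e -> satisfies (vs_Con U) e.
Proof.
move=> Le v; have [nu nuI] := nat_embedding K_infinite.
suff H (t r : lterm) : (forall w : nat -> L, leval w t = leval w r) ->
    forall x, leval v t x 0 -> leval v r x 0.
  apply: vs_Con_ext => x y; rewrite (vs_relE (leval v e.1)) (vs_relE (leval v e.2)).
  by split; apply: H.
move=> tr x /leval_pull[l hl]; set l' := x :: l.
pose s := [seq unitvect F (nu i) | i <- iota 0 (size l')].
have sl u : u \in l' -> exists2 y, span s y & combine l' nu y = u.
  move=> ul; have il : (index u l' < size l')%N by rewrite index_mem.
  exists (unitvect F (nu (index u l'))); last by rewrite combine_unitvect ?nth_index.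
  by apply/mem_span/mapP; exists (index u l') => //; rewrite mem_iota.
have [y sy yx] := sl x (mem_head _ _); rewrite -yx.
apply: (@pull_leval _ (combine l' nu) s v); rewrite -tr.
by apply: hl => // u ul; apply: sl; rewrite inE ul orbT.
Qed.

Definition fg_con (A : L) : vs_Con V := vs_of_subspace (fg_subspace A).

Lemma fg_conE A u : fg_con A u 0 <-> (A : set V) u.
Proof. by rewrite /= subr0. Qed.

Lemma vs_con_ker (U : lmodType F) (R S : vs_Con U) :
  (forall u, R u 0 <-> S u 0) -> R = S.
Proof.
by move=> RS; apply: vs_Con_ext => u v; rewrite (vs_relE R) (vs_relE S).
Qed.

Lemma fg_models : models L F.
Proof.
move=> e; split=> [Le U|VE]; first exact: fg_satisfies_Con.
apply: (satisfies_embed (f := fg_con)) (VE V) => A B; last 1 first.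
- apply: vs_con_ker => u; split.
    move=> /fg_conE[x [y [Ax By] uE]]; apply/ker_join; exists x, y => //.
    by split; apply/fg_conE.
  move=> /ker_join[x [y [/fg_conE Ax /fg_conE By] uE]]; apply/fg_conE.
  by exists x, y.
- by move=> AB; apply/fg_ext/seteqP; split=> u /fg_conE;
    [rewrite AB|rewrite -AB] => /fg_conE.
- apply: vs_con_ker => u; split.
    by move=> /fg_conE[Au Bu]; apply/ker_meet; split; apply/fg_conE.
  by move=> /ker_meet[/fg_conE Au /fg_conE Bu]; apply/fg_conE.
Qed.

End FgVectors.

(** * Congruences of the lattices of subspaces *)

Lemma lattice_congruence_eq d (L : latticeType d) : lattice_congruence (@eq L).
Proof.
split; first split.
- by [].
- by move=> x y ->.
- by move=> x y z -> ->.
- by move=> x x' y y' -> ->.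
- by move=> x x' y y' -> ->.
Qed.

Lemma lattice_congruence_full d (L : latticeType d) :
  lattice_congruence (fun _ _ : L => True).
Proof. by []. Qed.

Lemma cong_eq d (L : latticeType d) (R : L -> L -> Prop) : lattice_congruence R ->
  (forall x y, R x y -> x = y) -> R = eq.
Proof.
move=> HR h; apply/funext => x; apply/funext => y; apply/propext.
by split=> [/h//|->]; apply: cong_refl HR _.
Qed.

Section FgCongruences.
Variables (K : choiceType) (F : fieldType).
Hypothesis K_infinite : infinite_set [set: K].
Local Notation V := (finvect K F).

Lemma fin_neq b : exists X Y : fgsub V b,
  [/\ X <> Y, (exists s, X = fin b s) & exists s, Y = fin b s].
Proof.
have [nu _] := nat_embedding K_infinite.
exists (fin b [::]), (fin b [:: unitvect F (nu 0)]).
split; [|by exists [::]|by exists [:: unitvect F (nu 0)]].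
move=> /(congr1 (@fg_set _ _ _)) e; apply: (@unitvect_neq0 _ F (nu 0)).
by have := span_head (unitvect F (nu 0)) [::]; rewrite -[span _]e.
Qed.

Lemma fg_Con2 : Con (fgsub V false) #= `I_2.
Proof.
pose g n : fgsub V false -> fgsub V false -> Prop :=
  if n is 0 then eq else fun _ _ => True.
have -> : Con (fgsub V false) = g @` `I_2.
  apply/seteqP; split=> [R HR|_ [[|n] _ <-]]; last 2 first.
  - exact: lattice_congruence_eq.
  - exact: lattice_congruence_full.
  have [h|/existsNP[A /existsNP[B /not_implyP[RAB AB]]]] :=
      pselect (forall A B, R A B -> A = B).
    by exists 0 => //; rewrite (cong_eq HR h).
  exists 1 => //; apply/funext => X; apply/funext => Y; apply/propext; split=> // _.
  have [s ->] := fgsub_false X; have [t ->] := fgsub_false Y.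
  exact: fg_cong_collapse HR RAB AB.
apply: inj_card_eq => m n; have [X [Y [XY _ _]]] := fin_neq false.
move=> /set_mem + /set_mem.
case: m => [|[|//]]; case: n => [|[|//]] // _ _ /= e; case: XY.
  by rewrite (congr1 (fun R => R X Y) e).
by rewrite -(congr1 (fun R => R X Y) e).
Qed.

(** Adding the whole space on top creates one proper congruence, which separates
    the top from the finitely generated subspaces. *)
Lemma fg_Con3 : Con (fgsub V true) #= `I_3.
Proof.
pose finite (X : fgsub V true) := exists s, X = fin true s.
pose top : fgsub V true := FgSub (or_intror (conj isT erefl)).
have finVtop X : finite X \/ X = top.
  by case: (fg_setP X) => [[s Xs]|[_ XT]]; [left; exists s|right]; apply: fg_ext.
have topN : ~ finite top.
  by move=> [s /(congr1 (@fg_set _ _ _)) /esym]; apply: fin_proper.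
have finI X Y : finite X -> finite (Order.meet X Y).
  move=> [s ->]; have [//|e] := finVtop (Order.meet (fin true s) Y).
  case: (@fin_proper K F true K_infinite s); apply/seteqP; split=> // v _.
  by have : (top : set V) v by []; rewrite -e => -[].
have finU X Y : finite X -> finite Y -> finite (Order.join X Y).
  by move=> [s ->] [t ->]; exists (s ++ t); rewrite fin_cat.
have topU X : Order.join X top = top.
  apply: join_r; exact/fg_leP.
pose Rfin X Y := X = Y \/ finite X /\ finite Y.
have Rfin_cong : lattice_congruence Rfin.
  split; first split.
  - by left.
  - by move=> X Y [->|[]]; [left|right].
  - move=> X Y Z [->//|[fX fY]] [<-|[_ fZ]]; by right.
  - move=> X X' Y Y' [->|[fX fX']] [->|[fY fY']]; first by left.
    + by right; split; rewrite meetC; apply: finI.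
    + by right; split; apply: finI.
    + by right; split; apply: finI.
  - have H Z Y Y' : finite Y -> finite Y' -> Rfin (Order.join Z Y) (Order.join Z Y').
      move=> fY fY'; have [fZ|->] := finVtop Z; last by rewrite !(joinC top) !topU; left.
      by right; split; apply: finU.
    move=> X X' Y Y' [->|[fX fX']] [->|[fY fY']].
    + by left.
    + exact: H.
    + by rewrite !(joinC _ Y'); apply: H.
    + by right; split; apply: finU.
pose g n : fgsub V true -> fgsub V true -> Prop :=
  match n with 0 => eq | 1 => Rfin | _ => fun _ _ => True end.
have -> : Con (fgsub V true) = g @` `I_3.
  apply/seteqP; split=> [R HR|_ [[|[|n]] _ <-]] //; last exact: lattice_congruence_eq.
  have [h|/existsNP[A /existsNP[B /not_implyP[RAB AB]]]] :=
      pselect (forall A B, R A B -> A = B).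
    by exists 0 => //; rewrite (cong_eq HR h).
  have Rff X Y : finite X -> finite Y -> R X Y.
    by move=> [s ->] [t ->]; apply: fg_cong_collapse HR RAB AB.
  have [[X [fX RX]]|nR] := pselect (exists X, finite X /\ R X top).
    have RT Y : R Y top.
      have [fY|->] := finVtop Y; last exact: cong_refl HR _.
      exact: cong_trans HR _ _ _ (Rff _ _ fY fX) RX.
    exists 2 => //; apply/funext => Y; apply/funext => Z; apply/propext; split=> // _.
    exact: cong_trans HR _ _ _ (RT Y) (cong_sym HR (RT Z)).
  exists 1 => //; apply/funext => Y; apply/funext => Z; apply/propext; split=> /=.
    by move=> [->|[]]; [apply: cong_refl HR _|apply: Rff].
  move=> RYZ; have [fY|YT] := finVtop Y; have [fZ|ZT] := finVtop Z.
  - by right.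
  - by case: nR; exists Y; rewrite -ZT.
  - by case: nR; exists Z; rewrite -YT; split=> //; apply: cong_sym.
  - by left; rewrite YT ZT.
have [X [Y [XY fX fY]]] := fin_neq true.
have e01 : g 0 <> g 1.
  by move=> /(congr1 (fun R => R X Y)) /= e; apply: XY; rewrite e; right.
have e02 : g 0 <> g 2.
  by move=> /(congr1 (fun R => R X Y)) /= e; apply: XY; rewrite e.
have e12 : g 1 <> g 2.
  move=> /(congr1 (fun R => R X top)) /= e; have : Rfin X top by rewrite e.
  by move=> [XT|[_ /topN]//]; apply: topN; rewrite -XT.
apply: inj_card_eq => m n /set_mem + /set_mem.
by case: m => [|[|[|//]]]; case: n => [|[|[|//]]] // _ _ e;
  [case: (e01 (esym e))|case: (e02 (esym e))|case: (e12 (esym e))].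
Qed.

End FgCongruences.

(** * Lattices generating the variety *)

Lemma prime_field_countable p : countable [set: prime_field p].
Proof.
case: p => [|p]; first exact: (@countableP rat).
exact: (@countableP 'F_p.+1).
Qed.

Definition generating_lattice (K : Type) (F : fieldType) (c : nat) d
    (L : latticeType d) : Prop :=
  [/\ many_ideals K L, modular L, models L F & Con L #= `I_c].

Section GeneratingLattices.
Variables (K : Type) (F : fieldType).
Hypotheses (K_infinite : infinite_set [set: K]) (F_count : countable [set: F]).

Lemma generating_fgsub (b : bool) :
  generating_lattice K F (if b then 3 else 2) (fgsub (finvect {classic K} F) b).
Proof.
split.
- exact: (@fg_many_ideals {classic K} F b K_infinite F_count).
- exact: fg_modular.
- exact: (@fg_models {classic K} F b K_infinite).
- case: b; first exact: (@fg_Con3 {classic K} F K_infinite).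
  exact: (@fg_Con2 {classic K} F K_infinite).
Qed.
Lemma generating_prod c c' d d' (L : latticeType d) (M : latticeType d') :
  generating_lattice K F c L -> generating_lattice K F c' M ->
  generating_lattice K F (c * c') (L *p M).
Proof.
move=> [Lid Lmod LF LC] [Mid Mmod MF MC].
have inhab d0 (N : latticeType d0) : many_ideals K N -> exists x : N, True.
  move=> [_ /card_eqPle[_ /card_leTP[f _]] _].
  by have [nu _] := nat_embedding K_infinite; exists (f (nu 0)).
have [x0 _] := inhab _ _ Lid; have [y0 _] := inhab _ _ Mid.
split; [exact: many_ideals_prod|exact: modular_prod| |].
  move=> e; rewrite (satisfies_prod x0 y0) (LF e) (MF e).
  by split=> [[]|].
exact: card_eq_trans (Con_prod x0 y0) (card_setX_II LC MC).
Qed.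

Lemma generating_lattice_exists m n : m + n >= 1 ->
  exists (d : Order.disp_t) (L : latticeType d),
    generating_lattice K F (2 ^ m * 3 ^ n) L.
Proof.
have step (b : bool) c :
    c = 1 \/ (exists d (L : latticeType d), generating_lattice K F c L) ->
    exists d (L : latticeType d), generating_lattice K F ((if b then 3 else 2) * c) L.
  move=> [->|[d [L HL]]].
    rewrite muln1; eexists; exists (fgsub (finvect {classic K} F) b).
    exact: generating_fgsub.
  eexists; exists (fgsub (finvect {classic K} F) b *p L).
  exact: generating_prod (generating_fgsub b) HL.
suff H : 2 ^ m * 3 ^ n = 1 \/ exists d (L : latticeType d),
    generating_lattice K F (2 ^ m * 3 ^ n) L.
  case: H => [mn1|//] mn.
  have : (2 ^ m == 1) && (3 ^ n == 1) by rewrite -muln_eq1 mn1.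
  case: m mn {mn1} => [|m] mn; last by rewrite expnS muln_eq1.
  by case: n mn => // n _; rewrite expnS !muln_eq1.
elim: m => [|m IH].
  rewrite mul1n; elim: n => [|n IH]; first by left.
  by right; rewrite expnS; apply: (step true).
by right; rewrite expnS -mulnA; apply: (step false).
Qed.

End GeneratingLattices.

(** * Nested copies of M_3 *)

(** The copy of M_3 at level [i] has bottom [Bot i], atoms [Side true i] and
    [Side false i], and top [Top i]; its third atom is replaced by everything at
    the levels above [i], and innermost by the lattice [C]. Thus [Bot i] grows
    and [Top i] shrinks as [i] grows. *)
Inductive nest (W C : Type) : Type :=
| Bot of W
| Side of bool & W
| Top of W
| Core of C.
Arguments Bot {W C}.
Arguments Side {W C}.
Arguments Top {W C}.
Arguments Core {W C}.

Section Nest.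
Context {dW dC : Order.disp_t} (W : orderType dW) (C : latticeType dC).
Local Open Scope order_scope.
Local Notation N := (nest W C).
Implicit Types (x y z : N) (i j k : W) (a b : bool).

HB.instance Definition _ := gen_eqMixin N.
HB.instance Definition _ := gen_choiceMixin N.

Definition nest_le x y : bool :=
  match x, y with
  | Core c, Core e => c <= e
  | Core _, Top _ => true
  | Core _, _ => false
  | Bot i, Bot j | Bot i, Side _ j => i <= j
  | Bot _, _ => true
  | Side a i, Side b j => (i == j) && (a == b)
  | Side _ i, Top j => j <= i
  | Side _ _, _ => false
  | Top i, Top j => j <= i
  | Top _, _ => false
  end.

Definition nest_meet x y : N :=
  match x, y with
  | Core c, Core e => Core (Order.meet c e)
  | Core c, Top _ | Top _, Core c => Core c
  | Core _, Bot i | Core _, Side _ i | Bot i, Core _ | Side _ i, Core _ => Bot i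
  | Bot i, Bot j | Bot i, Side _ j | Side _ i, Bot j => Bot (Order.min i j)
  | Bot i, Top _ | Top _, Bot i => Bot i
  | Side a i, Side b j =>
      if (i == j) && (a == b) then Side a i else Bot (Order.min i j)
  | Side a i, Top j | Top j, Side a i => if j <= i then Side a i else Bot i
  | Top i, Top j => Top (Order.max i j)
  end.

Definition nest_join x y : N :=
  match x, y with
  | Core c, Core e => Core (Order.join c e)
  | Core c, Bot _ | Bot _, Core c => Core c
  | Core _, Top i | Core _, Side _ i | Top i, Core _ | Side _ i, Core _ => Top i
  | Top i, Top j | Top i, Side _ j | Side _ i, Top j => Top (Order.min i j)
  | Top i, Bot _ | Bot _, Top i => Top i
  | Side a i, Side b j =>
      if (i == j) && (a == b) then Side a i else Top (Order.min i j)
  | Side a i, Bot j | Bot j, Side a i => if j <= i then Side a i else Top i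
  | Bot i, Bot j => Bot (Order.max i j)
  end.

Lemma nest_le_refl : reflexive nest_le.
Proof. by case=> [i|a i|i|c] /=; rewrite ?eqxx ?lexx. Qed.

Lemma nest_le_anti : antisymmetric nest_le.
Proof.
case=> [i|a i|i|c] [j|b j|j|e] //=; rewrite ?andbF //.
- by move=> /le_anti->.
- by move=> /andP[/andP[/eqP-> /eqP->]].
- by rewrite andbC => /le_anti->.
- by move=> /le_anti->.
Qed.

Lemma nest_le_trans : transitive nest_le.
Proof.
case=> [i|a i|i|c] [j|b j|j|e] [k|b' k|k|f] //=; try exact: le_trans.
- by move=> ji /andP[/eqP <-].
- by move=> /andP[/eqP -> /eqP->].
- by move=> /andP[/eqP -> _].
- by move=> ij ki; apply: le_trans ij.
- by move=> ij ki; apply: le_trans ij.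
Qed.

Lemma nest_meetP x y z : nest_le x (nest_meet y z) = nest_le x y && nest_le x z.
Proof.
case: x y z => [i|a i|i|c] [j|b j|j|e] [k|b' k|k|f] //=;
  rewrite ?andbT ?andbF ?le_min ?ge_max ?lexI //; case: ifP => //.
- by case/andP=> /eqP-> _; rewrite andbb.
- by rewrite le_min.
- by case/andP=> /eqP-> /eqP->; rewrite andbb.
- move=> jk; apply/esym/negbTE; apply: contraFN jk.
  by move=> /andP[/andP[/eqP<- /eqP<-]].
- by case: (eqVneq i j) => //= <- ->; rewrite andbT.
- by case: (eqVneq i j) => //= <- ->; rewrite andbF.
- by case: (eqVneq i k) => [<- ->|_ _] //=; rewrite andbF.
- by case: (eqVneq i k) => [<- ->|_ _] //=; rewrite andbF.
Qed.

Lemma nest_joinP x y z : nest_le (nest_join x y) z = nest_le x z && nest_le y z.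
Proof.
case: x y z => [i|a i|i|c] [j|b j|j|e] [k|b' k|k|f] //=;
  rewrite ?andbT ?andbF ?le_min ?ge_max ?leUx //; case: ifP => //.
- by move=> ij /=; case: (eqVneq j k) => [<-|]; rewrite ?ij ?andbF.
- by move=> ij /=; case: (eqVneq j k) => [<-|]; rewrite ?ij ?andbF.
- by move=> ji /=; case: (eqVneq i k) => [<-|]; rewrite ?ji ?andbT.
- by move=> ji /=; case: (eqVneq i k) => [<-|]; rewrite ?ji ?andbF.
- by case/andP=> /eqP<- /eqP<- /=; rewrite andbb.
- move=> ij; apply/esym/negbTE; apply: contraFN ij.
  by move=> /andP[/andP[/eqP-> /eqP->]] /andP[/eqP-> /eqP->]; rewrite !eqxx.
- by case/andP=> /eqP<- _ /=; rewrite andbb.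
- by rewrite /= le_min.
Qed.

Fact nest_display : Order.disp_t. Proof. exact: Order.Disp tt tt. Qed.

HB.instance Definition _ := Order.Le_isPOrder.Build nest_display N
  nest_le_refl nest_le_anti nest_le_trans.
HB.instance Definition _ := Order.POrder_MeetJoin_isLattice.Build
  nest_display N nest_meetP nest_joinP.

Lemma nest_leE x y : (x <= y) = nest_le x y. Proof. by []. Qed.
Lemma nest_meetE x y : Order.meet x y = nest_meet x y. Proof. by []. Qed.
Lemma nest_joinE x y : Order.join x y = nest_join x y. Proof. by []. Qed.

Definition level x : option W :=
  match x with Bot i | Side _ i | Top i => Some i | Core _ => None end.

(** These elements take the place of the third atom of the copy at level [i]. *)
Definition inside i x : bool := if level x is Some j then i < j else true.

Lemma Side_join a i x : inside i x -> Order.join (Side a i) x = Top i.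
Proof.
rewrite nest_joinE /inside; case: x => [j|b j|j|c] //= ij.
- by rewrite leNgt ij.
- by rewrite (lt_eqF ij) /= min_l // ltW.
- by rewrite min_l // ltW.
Qed.

Lemma Side_meet a i x : inside i x -> Order.meet (Side a i) x = Bot i.
Proof.
rewrite nest_meetE /inside; case: x => [j|b j|j|c] //= ij.
- by rewrite min_l // ltW.
- by rewrite (lt_eqF ij) /= min_l // ltW.
- by rewrite leNgt ij.
Qed.

Lemma Side_joinN a i : Order.join (Side a i) (Side (~~ a) i) = Top i.
Proof. by rewrite nest_joinE /= eqxx; case: a; rewrite /= minxx. Qed.

Lemma Side_meetN a i : Order.meet (Side a i) (Side (~~ a) i) = Bot i.
Proof. by rewrite nest_meetE /= eqxx; case: a; rewrite /= minxx. Qed.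

Lemma Bot_le i x : inside i x -> Bot i <= x.
Proof. by rewrite nest_leE /inside; case: x => [j|b j|j|c] //= /ltW. Qed.

Lemma le_Top i x : inside i x -> x <= Top i.
Proof. by rewrite nest_leE /inside; case: x => [j|b j|j|c] //= /ltW. Qed.

Lemma Bot_meet i x : inside i x -> Order.meet (Bot i) x = Bot i.
Proof. by move=> /Bot_le/meet_l. Qed.

Lemma Bot_join i x : inside i x -> Order.join (Bot i) x = x.
Proof. by move=> /Bot_le/join_r. Qed.

Lemma Top_meet i x : inside i x -> Order.meet (Top i) x = x.
Proof. by move=> /le_Top/meet_r. Qed.

Lemma Top_join i x : inside i x -> Order.join (Top i) x = Top i.
Proof. by move=> /le_Top/join_l. Qed.

Lemma Bot_le_Side a i : (Bot i : N) <= Side a i.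
Proof. by rewrite nest_leE /=. Qed.

Lemma Side_le_Top a i : (Side a i : N) <= Top i.
Proof. by rewrite nest_leE /=. Qed.

(** M_3 is simple: a pair related by [R] at level [i] collapses the whole level,
    by perspectivities between its three atoms, the third of which is
    represented by an arbitrary element [Core c0]. *)
Section Collapse.
Variable R : N -> N -> Prop.
Hypothesis HR : lattice_congruence R.
Variables (c0 : C) (i : W).

Lemma collapse_Bot_Side a : R (Bot i) (Side a i) -> R (Bot i) (Top i).
Proof.
move=> Ra; have Rc : R (Core c0) (Top i).
  have := cong_join HR Ra (cong_refl HR (Core c0)).
  by rewrite Bot_join // Side_join.
have Rna : R (Bot i) (Side (~~ a) i).
  have := cong_meetl HR (Side (~~ a) i) Rc.
  by rewrite Side_meet // meet_l ?Side_le_Top.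
have := cong_join HR Ra Rna.
by rewrite joinxx Side_joinN.
Qed.

Lemma collapse_Side_Top a : R (Side a i) (Top i) -> R (Bot i) (Top i).
Proof.
move=> Ra; apply: (@collapse_Bot_Side (~~ a)).
have := cong_meetl HR (Side (~~ a) i) Ra.
by rewrite (meet_l (Side_le_Top _ _)) -{2}(negbK a) Side_meetN.
Qed.

Lemma collapse_Bot x : inside i x -> R (Bot i) x -> R (Bot i) (Top i).
Proof.
move=> ix Rx; apply: (@collapse_Side_Top true).
have := cong_joinl HR (Side true i) Rx.
by rewrite (Side_join _ ix) join_l ?Bot_le_Side.
Qed.

Lemma collapse_Side a x : inside i x -> R (Side a i) x -> R (Bot i) (Top i).
Proof.
move=> ix Rx; apply: (@collapse_Bot_Side a); apply: (cong_sym HR).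
by have := cong_meetl HR (Side a i) Rx; rewrite meetxx Side_meet.
Qed.

Lemma collapse_Top x : inside i x -> R (Top i) x -> R (Bot i) (Top i).
Proof.
move=> ix Rx; apply: (@collapse_Bot_Side true); apply: (cong_sym HR).
have := cong_meetl HR (Side true i) Rx.
by rewrite (Side_meet _ ix) meet_l ?Side_le_Top.
Qed.

Lemma collapse_Sides : R (Side true i) (Side false i) -> R (Bot i) (Top i).
Proof.
move=> Rx; apply: (@collapse_Bot_Side true); apply: (cong_sym HR).
by have := cong_meetl HR (Side true i) Rx; rewrite meetxx (Side_meetN true).
Qed.

Lemma collapse_inside x y :
  level x = Some i -> inside i y -> R x y -> R (Bot i) (Top i).
Proof.
case: x => [j|a j|j|c] //= [->]; [exact: collapse_Bot|exact: collapse_Side|].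
exact: collapse_Top.
Qed.

Lemma collapse_same_level x y : level x = Some i -> level y = Some i ->
  R x y -> x <> y -> R (Bot i) (Top i).
Proof.
case: x => [j|a j|j|c] //= [->]; case: y => [k|b k|k|e] //= [->] Rxy ne //.
- exact: collapse_Bot_Side Rxy.
- exact/collapse_Bot_Side/(cong_sym HR Rxy).
- case: a b Rxy ne => -[] // Rxy _; first exact: collapse_Sides.
  exact/collapse_Sides/(cong_sym HR Rxy).
- exact: collapse_Side_Top Rxy.
- exact: (cong_sym HR Rxy).
- exact/collapse_Side_Top/(cong_sym HR Rxy).
Qed.

End Collapse.

(** These are the sets of elements that a congruence can collapse on their own. *)
Definition block (o : option W) x : bool :=
  if level x is Some j then (if o is Some i then i <= j else false) else true.

Definition block_cong o x y : Prop := x = y \/ block o x /\ block o y.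

Lemma block_meet o x y : block o x -> block o y -> block o (Order.meet x y).
Proof.
rewrite nest_meetE /block; case: o => [k|].
  case: x y => [i|a i|i|c] [j|b j|j|e] //=; do ?case: ifP => //=;
  by rewrite ?le_min ?le_max => *; apply/andP || apply/orP; auto.
by case: x y => [i|a i|i|c] [j|b j|j|e].
Qed.

Lemma block_join o x y : block o x -> block o y -> block o (Order.join x y).
Proof.
rewrite nest_joinE /block; case: o => [k|].
  case: x y => [i|a i|i|c] [j|b j|j|e] //=; do ?case: ifP => //=;
  by rewrite ?le_min ?le_max => *; apply/andP || apply/orP; auto.
by case: x y => [i|a i|i|c] [j|b j|j|e].
Qed.

(** An element outside a block sees all of it as its third atom, so its meets
    and joins with the members of the block are either constant or trivial. *)
Lemma outside_block o z : ~~ block o z ->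
  exists2 j, level z = Some j & forall x, block o x -> inside j x.
Proof.
rewrite /block /inside; case: (level z) => // j oj; exists j => // x.
case: (level x) => // k; case: o oj => //= i; rewrite -ltNge; exact: lt_le_trans.
Qed.

Lemma outside_meet j z x x' : level z = Some j -> inside j x -> inside j x' ->
  Order.meet z x = Order.meet z x' \/
  (Order.meet z x = x /\ Order.meet z x' = x').
Proof.
case: z => [k|a k|k|c] //= [->] jx jx'.
- by left; rewrite !Bot_meet.
- by left; rewrite !Side_meet.
- by right; rewrite !Top_meet.
Qed.

Lemma outside_join j z x x' : level z = Some j -> inside j x -> inside j x' ->
  Order.join z x = Order.join z x' \/
  (Order.join z x = x /\ Order.join z x' = x').
Proof.
case: z => [k|a k|k|c] //= [->] jx jx'.
- by right; rewrite !Bot_join.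
- by left; rewrite !Side_join.
- by left; rewrite !Top_join.
Qed.

Lemma block_congP o : lattice_congruence (block_cong o).
Proof.
have meetl z x x' : block o x -> block o x' ->
    block_cong o (Order.meet z x) (Order.meet z x').
  move=> ox ox'; have [oz|/outside_block[j zj oj]] := boolP (block o z).
    by right; split; apply: block_meet.
  have [|[-> ->]] := outside_meet zj (oj _ ox) (oj _ ox'); first by left.
  by right.
have joinl z x x' : block o x -> block o x' ->
    block_cong o (Order.join z x) (Order.join z x').
  move=> ox ox'; have [oz|/outside_block[j zj oj]] := boolP (block o z).
    by right; split; apply: block_join.
  have [|[-> ->]] := outside_join zj (oj _ ox) (oj _ ox'); first by left.
  by right.
split; first split.
- by left.
- by move=> x y [->|[]]; [left|right].
- by move=> x y z [->//|[ox oy]] [<-|[_ oz]]; right.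
- move=> x x' y y' [->|[ox ox']] [->|[oy oy']].
  + by left.
  + exact: meetl.
  + by rewrite !(meetC _ y'); apply: meetl.
  + by right; split; apply: block_meet.
- move=> x x' y y' [->|[ox ox']] [->|[oy oy']].
  + by left.
  + exact: joinl.
  + by rewrite !(joinC _ y'); apply: joinl.
  + by right; split; apply: block_join.
Qed.

Section Classification.
Hypothesis W_wf : forall P : set W, P !=set0 ->
  exists2 i, P i & forall j, P j -> i <= j.
Hypothesis C_simple : forall R (c e u v : C),
  lattice_congruence R -> R c e -> c <> e -> R u v.
Variables (c0 c1 : C).
Hypothesis c01 : c0 <> c1.

Lemma block_between i x : block (Some i) x -> Bot i <= x <= Top i.
Proof. by rewrite !nest_leE /block; case: x => [j|a j|j|c] //= ->. Qed.

(** The outer one of the levels of two related elements is collapsed, unless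
    both elements lie in the core. *)
Lemma nest_cong_level R x y : lattice_congruence R -> R x y -> x <> y ->
  (exists i, [/\ R (Bot i) (Top i), block (Some i) x & block (Some i) y]) \/
  (exists c e, [/\ x = Core c, y = Core e & c <> e]).
Proof.
move=> HR; wlog : x y / match level x, level y with
    | Some i, Some j => i <= j | None, Some _ => false | _, _ => true end.
  move=> H Rxy ne; have Ryx := cong_sym HR Rxy; have ne' := nesym ne.
  have sym : ((exists i, [/\ R (Bot i) (Top i), block (Some i) y & block (Some i) x]) \/
      (exists c e, [/\ y = Core c, x = Core e & c <> e])) ->
    ((exists i, [/\ R (Bot i) (Top i), block (Some i) x & block (Some i) y]) \/
      (exists c e, [/\ x = Core c, y = Core e & c <> e])).
    move=> [[i [? ? ?]]|[c [e [? ? /nesym ?]]]]; first by left; exists i.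
    by right; exists e, c.
  case Ex: (level x) => [i|]; case Ey: (level y) => [j|].
  - case/orP: (le_total i j) => ij; first by apply: H; rewrite ?Ex ?Ey.
    by apply: sym; apply: H; rewrite ?Ex ?Ey.
  - by apply: H; rewrite ?Ex ?Ey.
  - by apply: sym; apply: H; rewrite ?Ex ?Ey.
  - by apply: H; rewrite ?Ex ?Ey.
rewrite /block; case Ex: (level x) => [i|]; case Ey: (level y) => [j|] // ij Rxy ne.
- left; exists i; split=> //; move: ij; rewrite le_eqVlt => /predU1P[ij|ij].
    by apply: (collapse_same_level HR c0 Ex _ Rxy ne); rewrite Ey -ij.
  by apply: (collapse_inside HR c0 Ex _ Rxy); rewrite /inside Ey.
- left; exists i; split=> //.
  by apply: (collapse_inside HR c0 Ex _ Rxy); rewrite /inside Ey.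
- right; case: x y Ex Ey ne {Rxy} => // c [] // e _ _ ne; exists c, e.
  by split=> // ce; apply: ne; rewrite ce.
Qed.

Lemma Core_cong R : lattice_congruence R ->
  lattice_congruence (fun c e : C => R (Core c) (Core e)).
Proof.
move=> HR; split; first split.
- by move=> c; apply: cong_refl HR _.
- by move=> c e; apply: cong_sym HR _ _.
- by move=> c e f; apply: cong_trans HR _ _ _.
- by move=> c c' e e' h k; have := cong_meet HR h k.
- by move=> c c' e e' h k; have := cong_join HR h k.
Qed.

Lemma nest_Con_block R : lattice_congruence R ->
  R = eq \/ exists o, R = block_cong o.
Proof.
move=> HR; have [h|/existsNP[x /existsNP[y /not_implyP[Rxy xy]]]] :=
    pselect (forall x y, R x y -> x = y).
  by left; apply: cong_eq.
right; have Rcore c e : R (Core c) (Core e).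
  have [[i [Ri _ _]]|[c' [e' [xc ye ce]]]] := nest_cong_level HR Rxy xy.
    by apply: (cong_convex HR Ri).
  by apply: (@C_simple _ c' e' c e (Core_cong HR)) => //; rewrite -xc -ye.
have out o : (forall i, R (Bot i) (Top i) -> if o is Some k then k <= i else false) ->
    (forall x y, block o x -> block o y -> R x y) -> R = block_cong o.
  move=> oR Ro; apply/funext => u; apply/funext => v; apply/propext.
  split=> [Ruv|[->|[]]]; [|exact: cong_refl HR _|exact: Ro].
  have [->|uv] := pselect (u = v); first by left.
  right; have [[i [Ri ui vi]]|[c [e [-> -> _]]]] // := nest_cong_level HR Ruv uv.
  have := oR i Ri; case: o {oR Ro} => // k ki.
  suff H z : block (Some i) z -> block (Some k) z by split; apply: H.
  by rewrite /block; case: (level z) => // j; apply: le_trans.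
have [Rn|nR] := pselect ([set i | R (Bot i) (Top i)] !=set0).
  have [k Rk kmin] := W_wf Rn; exists (Some k); apply: out => // u v.
  move=> /block_between/andP[ku uk] /block_between/andP[kv vk].
  exact: (cong_convex HR Rk).
exists None; apply: out => [i Ri|u v]; first by case: nR; exists i.
by rewrite /block; case: u => // c _; case: v => // e _.
Qed.

(** Equality, the collapse of the core, and the collapse of everything from a
    given level on. *)
Lemma nest_Con : Con N #= [set: option (option W)].
Proof.
pose h (p : option (option W)) := if p is Some o then block_cong o else eq.
have -> : Con N = range h.
  apply/seteqP; split=> [R HR|_ [[o|] _ <-]].
  - have [->|[o ->]] := nest_Con_block HR; first by exists None.
    by exists (Some o).
  - exact: block_congP.
  - exact: lattice_congruence_eq.
apply: inj_card_eq => p q _ _.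
have coreN o : block_cong o <> eq.
  move=> /(congr1 (fun R => R (Core c0) (Core c1))) e.
  have : Core c0 = Core c1 :> N by rewrite -e; right.
  by case.
have lvl o i : block_cong o (Bot i) (Top i) <-> (if o is Some k then k <= i else false).
  by rewrite /block_cong /block /=; case: o => [k|]; split=> [[//|[]//]|ki] //; right.
case: p q => [o|] [o'|] //= e; [|by have := coreN o e|by have := coreN o' (esym e)].
congr Some; have {}e i : (if o is Some k then k <= i else false) <->
    (if o' is Some k then k <= i else false).
  by rewrite -!lvl e.
case: o o' e => [k|] [k'|] // e.
- by congr Some; apply/le_anti/andP; split; apply/e.
- by have /e := lexx k.
- by have /e := lexx k'.
Qed.

Hypothesis C_dcc : dcc C.

(** The elements other than tops are downward closed and satisfy the descending
    chain condition, so a filter containing one of them has a least element;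
    tops descend along [W], so that a filter of tops is cut out by the first
    level missing from it. *)
Lemma nest_filter F : lattice_filter F ->
  (exists m, F = [set x | m <= x]) \/
  exists o : option W,
    F = [set x | exists2 i, x = Top i & if o is Some k then i < k else true].
Proof.
move=> [F0 Fup FI].
have least m : F m -> (forall x, F x -> x <= m -> x = m) -> F = [set x | m <= x].
  move=> Fm mmin; apply/seteqP; split=> [x Fx|x]; last exact: Fup.
  by rewrite /= -(mmin (Order.meet m x)) ?leIr ?leIl//; apply: FI.
have [FB|nFB] := pselect ([set i | F (Bot i)] !=set0).
  have [i FBi imin] := W_wf FB; left; exists (Bot i); apply: least => // x Fx.
  rewrite nest_leE; case: x Fx => [j|b j|j|c] //= Fj ji.
  by congr Bot; apply/le_anti; rewrite ji imin.
have [[a [i FS]]|nFS] := pselect (exists a i, F (Side a i)).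
  left; exists (Side a i); apply: least => // x Fx.
  rewrite nest_leE; case: x Fx => [j|b j|j|c] //= Fj; last by move=> /andP[/eqP-> /eqP->].
  by case: nFB; exists j.
have [FC|nFC] := pselect ([set c | F (Core c)] !=set0).
  have [c FCc cmin] := C_dcc FC; left; exists (Core c); apply: least => // x Fx.
  rewrite nest_leE; case: x Fx => [j|b j|j|e] //= Fe.
    by case: nFB; exists j.
  by move=> /(cmin _ Fe)->.
have FT x : F x -> exists i, x = Top i.
  case: x => [j|b j|j|e] Fx; last by case: nFC; exists e.
  - by case: nFB; exists j.
  - by case: nFS; exists b, j.
  - by exists j.
right; have [Tn|/forallNP Tall] := pselect ([set i | ~ F (Top i)] !=set0).
  have [k Fk kmin] := W_wf Tn; exists (Some k); apply/seteqP; split=> x.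
    move=> /[dup] Fx /FT[i xi]; exists i => //; rewrite ltNge; apply/negP => ki.
    by apply: Fk; apply: Fup Fx _; rewrite xi nest_leE.
  move=> [i -> ik]; apply: contrapT => /kmin; by rewrite leNgt ik.
exists None; apply/seteqP; split=> x; first by move=> /FT[i ->]; exists i.
by move=> [i -> _]; apply: contrapT => /Tall.
Qed.

Lemma nest_Filt (K : Type) : infinite_set [set: K] ->
  [set: W] #<= [set: K] -> [set: N] #= [set: K] -> Filt N #= [set: K].
Proof.
move=> Kinf WK /card_eqPle[NK KN]; apply: Cantor_Bernstein; last first.
  exact: card_le_trans KN (card_le_Filt N).
pose g (p : N + option W) : set N := match p with
  | inl m => [set x | m <= x]
  | inr o => [set x | exists2 i, x = Top i & if o is Some k then i < k else true]
  end.
apply: card_le_trans (card_sum_le Kinf NK (card_option_le Kinf WK)).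
apply: (card_le_trans _ (card_image_le g setT)); apply: subset_card_le => F.
by move=> /nest_filter[[m ->]|[o ->]]; [exists (inl m)|exists (inr o)].
Qed.

End Classification.

Lemma nest_card (K : Type) : infinite_set [set: K] ->
  [set: W] #<= [set: K] -> [set: C] #= [set: K] -> [set: N] #= [set: K].
Proof.
move=> Kinf WK /card_eqPle[CK KC]; apply: Cantor_Bernstein.
  apply: card_le_trans (card_sum_le Kinf CK
    (card_prod_le Kinf (card_nat_le Kinf) WK)); apply/card_leTP.
  exists (fun x => match x with
    | Core c => inl c | Bot i => inr (0%N, i) | Side a i => inr (a.+1, i)
    | Top i => inr (3%N, i) end).
  by move=> [i|[] i|i|c] [j|[] j|j|e] // [->].
by apply: card_le_trans KC _; apply/card_leTP; exists Core => c e [].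
Qed.

Lemma nest_Id T (X : set T) : X #<= Id C -> X #<= Id N.
Proof. exact: (card_Id_embed (f := Core)). Qed.

End Nest.

(** * Well-ordered levels *)

Section WellOrderedType.
Variables (T : choiceType) (R : rel T) (R_wo : well_order R).

(** The well-order is an argument, so that the order can be attached to it. *)
Definition wo_type (_ : well_order R) : Type := T.
Local Notation W := (wo_type R_wo).
HB.instance Definition _ := Choice.on W.

Lemma wo_min (P : set T) : P !=set0 ->
  exists2 z, P z & forall x, P x -> R z x.
Proof.
move=> [x0 Px0]; have [|z [[/asboolP Pz zmin] _]] := R_wo (A := fun x => `[< P x >]).
  by exists x0; apply/asboolP.
by exists z => // x Px; apply: zmin; apply/asboolP.
Qed.

Lemma wo_refl : reflexive R.
Proof.
move=> x; have [|z -> h] := @wo_min [set x]; first by exists x.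
exact: h.
Qed.

Lemma wo_total : total R.
Proof.
move=> x y; have [|z [->|->] h] := @wo_min [set x; y]; first by exists x; left.
  by rewrite h //; right.
by rewrite orbC h //; left.
Qed.

Lemma wo_anti : antisymmetric R.
Proof.
move=> x y /andP[Rxy Ryx].
have [|z [_ zU]] := R_wo (A := [pred u | (u == x) || (u == y)]).
  by exists x; rewrite inE eqxx.
have <- : z = x.
  apply: zU; split=> [|u]; rewrite inE ?eqxx // => /orP[/eqP->|/eqP->] //.
  exact: wo_refl.
apply: zU; split=> [|u]; rewrite inE ?eqxx ?orbT // => /orP[/eqP->|/eqP->] //.
exact: wo_refl.
Qed.

Lemma wo_trans : transitive R.
Proof.
move=> y x z Rxy Ryz.
have [|m mE h] := @wo_min [set m | [\/ m = x, m = y | m = z]].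
  by exists x; constructor 1.
have Rmx : R m x by apply: h; constructor 1.
have Rmy : R m y by apply: h; constructor 2.
have Rmz : R m z by apply: h; constructor 3.
case: mE => mE; rewrite mE in Rmx Rmy Rmz => //.
  by rewrite (@wo_anti x y) ?Rxy.
by rewrite -(@wo_anti y z) // Ryz.
Qed.

Fact wo_display : Order.disp_t. Proof. exact: Order.Disp tt tt. Qed.

HB.instance Definition _ := Order.Le_isPOrder.Build wo_display W
  wo_refl wo_anti wo_trans.
HB.instance Definition _ := Order.POrder_isTotal.Build wo_display W wo_total.

End WellOrderedType.

(** The core is a lattice of finitely generated subspaces, which is simple and
    has enough ideals. *)
Lemma nested_lattice (K : Type) (S : choiceType) : infinite_set [set: K] ->
  [set: S] #<= [set: K] ->
  exists (d : Order.disp_t) (L : latticeType d),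
    [/\ Con L #= [set: option (option S)], Filt L #= [set: K]
      & Id L #= [set: set K]].
Proof.
move=> Kinf SK; have [R Rwo] := well_ordering_principle S.
pose W : orderType _ := wo_type Rwo.
pose C := fgsub (finvect {classic K} rat) false.
have rat_count : countable [set: rat] by exact: countableP.
have [Cdcc Ccard CId] : many_ideals K C.
  exact: (@fg_many_ideals {classic K} rat false Kinf rat_count).
have [c0 [c1 [c01 _ _]]] := @fin_neq {classic K} rat Kinf false.
have Csimple (Q : C -> C -> Prop) (c e u v : C) :
    lattice_congruence Q -> Q c e -> c <> e -> Q u v.
  move=> HQ Qce ce; have [s ->] := fgsub_false u; have [t ->] := fgsub_false v.
  exact: fg_cong_collapse HQ Qce ce.
have Ncard : [set: nest W C] #= [set: K] by apply: nest_card.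
have Wwf (P : set W) : P !=set0 -> exists2 i, P i & forall j, P j -> (i <= j)%O.
  exact: wo_min.
eexists; exists (nest W C : latticeType _); split.
- exact: (nest_Con Wwf Csimple c01).
- exact: (nest_Filt Wwf Cdcc Kinf SK Ncard).
- apply: card_Id; last exact: nest_Id CId.
  by move/card_eqPle: Ncard => [].
Qed.

(** Equality and the collapse of the core account for the two congruences that do
    not come from a level. *)
Lemma remove_two (T : Type) : `I_2 #<= [set: T] ->
  exists P : set T, [set: option (option {x | P x})] #= [set: T].
Proof.
move=> le2; have [l0 [l1 l01]] : exists l0 l1 : T, l0 <> l1.
  have : [set: bool] #<= [set: T].
    apply: card_le_trans le2; apply: (card_le_inj (f := nat_of_bool)).
      by case.
    by move=> [] [].
  move=> /card_leTP[f fI]; exists (f true), (f false) => /fI //.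
exists [set x | x <> l0 /\ x <> l1].
pose h (o : option (option {x | x <> l0 /\ x <> l1})) := match o with
  | None => l0 | Some None => l1 | Some (Some x) => sval x end.
suff <- : range h = [set: T].
  apply: card_esym; apply: inj_card_eq => o o' _ _.
  case: o o' => [[[x [x0 x1]]|]|] [[[y [y0 y1]]|]|] //=.
  - by move=> xy; congr (Some (Some _)); apply: eq_exist.
  - by move=> /esym.
  - by move=> /esym.
  - by move=> /esym.
apply/seteqP; split=> // x _.
have [->|x0] := pselect (x = l0); first by exists None.
have [->|x1] := pselect (x = l1); first by exists (Some None).
by exists (Some (Some (exist _ x (conj x0 x1)))).
Qed.

Theorem theorem1p1 (K : Type) (K_infinite : infinite_set [set: K]) :
  (forall Lam : Type,
     `I_2 #<= [set: Lam] -> [set: Lam] #<= [set: K] ->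
     exists (d : Order.disp_t) (L : latticeType d),
       [/\ Con L #= [set: Lam],
           Filt L #= [set: K]
         & Id L #= [set: set K]])
  /\
  (exists (d : Order.disp_t) (L : distrLatticeType d),
     [/\ Con L #= [set: set K],
         Filt L #= [set: K]
       & Id L #= [set: set K]])
  /\
  (forall p : nat, prime p \/ p = 0 ->
     (forall m n : nat, m + n >= 1 ->
        exists (d : Order.disp_t) (L : latticeType d),
          modular L /\ variety_p p L /\ generates L (variety_p p) /\
          [/\ Con L #= `I_(2 ^ m * 3 ^ n),
              Filt L #= [set: K]
            & Id L #= [set: set K]])
     /\
     (exists (d : Order.disp_t) (L : latticeType d),
        modular L /\ variety_p p L /\ generates L (variety_p p) /\
        [/\ Con L #= `I_(2 ^ 1 * 3 ^ 0),
            Filt L #= [set: K]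
          & Id L #= [set: set K]] /\
        relatively_complemented L)).
Proof.
split; [|split].
- move=> Lam Lam2 LamK; have [P PLam] := remove_two Lam2.
  have PK : [set: {classic {x | P x}}] #<= [set: K].
    apply: card_le_trans LamK; apply/card_leTP; exists sval.
    by move=> [x Px] [y Py] /= xy; apply: eq_exist.
  have [d [L [LC LF LI]]] := nested_lattice K_infinite PK.
  exists d, L; split=> //.
  exact: card_eq_trans LC PLam.
- eexists; exists (finsubset {classic K}).
  have [LF LI] := many_ideals_card (@finsubset_many_ideals {classic K} K_infinite).
  split; [exact: finsubset_Con|exact: LF|exact: LI].
- move=> p _; have F_count := prime_field_countable p.
  have finish c d (L : latticeType d) :
      generating_lattice K (prime_field p) c L ->
      modular L /\ variety_p p L /\ generates L (variety_p p) /\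
      [/\ Con L #= `I_c, Filt L #= [set: K] & Id L #= [set: set K]].
    move=> [/many_ideals_card[LF LI] Lmod /models_variety[Lp Lgen] LC].
    by split; [exact: Lmod|split; [exact: Lp|split; [exact: Lgen|split]]].
  split=> [m n mn|].
    have [d [L /finish HL]] := generating_lattice_exists K_infinite F_count mn.
    by exists d, L.
  have /finish := generating_fgsub K_infinite F_count false.
  move=> [H1 [H2 [H3 H4]]]; eexists.
  exists (fgsub (finvect {classic K} (prime_field p)) false).
  split; [exact: H1|split; [exact: H2|split; [exact: H3|split; first exact: H4]]].
  exact: fg_relatively_complemented.
Qed.
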